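(* Let $G$ be a finite group with exponent $n_1=2^mp_1^{m_1}\cdots p_r^{m_r}$. Let $C(i),C(1),C(-1)\subseteq G\setminus\{1\}$ be unions of conjugacy classes such that $C(i),C(i)^{-1},C(1),C(-1)$ are pairwise disjoint and $C(1)=C(1)^{-1}$, $C(-1)=C(-1)^{-1}$, and let $M=iA_{C(i)}-iA_{C(i)^{-1}}+A_{C(1)}-A_{C(-1)}$ (the Hermitian matrix of the mixed normal Cayley graph $X(G,C(i),C(1),C(-1))$). Then the continuous quantum walk $\exp(itM)$ is periodic if and only if there is a positive square-free integer $D$ such that: if $-D$ is an admissible value then $C(i)$ is a union of $\sim_{-D}$ equivalence classes, and otherwise $C(i)=\emptyset$; and if $D$ is an admissible value then $C(1)$ and $C(-1)$ are unions of $\sim_D$ equivalence classes and, when $D\ne1$, $C(1)=C(-1)^k$ for some $k\in\mathbb{Z}_{n_1}^*\setminus H_D$, and otherwise $C(1)=C(-1)=\emptyset$.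
   Context: $G$ is written multiplicatively; $A_g$ is the permutation matrix with $(A_g)_{a,b}=1$ iff $ba^{-1}=g$; $A_C=\sum_{g\in C}A_g$; $C^{-1}=\{g^{-1}:g\in C\}$ and $C^k=\{g^k:g\in C\}$. The exponent $n_1$ is the least positive integer with $g^{n_1}=1$ for all $g$, and $p_1,\ldots,p_r$ are distinct odd primes. An integer $\Delta$ is admissible if $\Delta=2^{w_0}(-1)^w\prod_{k=1}^r\big((-1)^{(p_k-1)/2}p_k\big)^{w_k}$ with $w,w_0,\ldots,w_r\in\{0,1\}$, $w_0=0$ if $m<3$, $w=0$ if $m<2$. For such $\Delta$, $H_\Delta=\{k\in\mathbb{Z}_{n_1}^*:\chi(k)^{w_0}\left(\frac k4\right)^w\prod_j\left(\frac k{p_j}\right)^{w_j}=1\}$, where $\left(\frac kp\right)$ is the Legendre symbol, $\left(\frac k4\right)=\pm1$ according as $k\equiv\pm1\pmod4$, and $\chi(k)=1$ if $k\equiv\pm1\pmod 8$, $-1$ if $k\equiv\pm3\pmod8$; and $g\sim_\Delta h$ iff $g$ is conjugate to $h^k$ for some $k\in H_\Delta$. The walk $\exp(itM)$ is periodic if there exists $t\neq0$ with $\exp(itM)=\gamma I$ for some scalar $\gamma$ (equivalently, periodic at some vertex $a$: $\exp(itM)e_a=\alpha e_a$). *)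

(* Defs.v *)
From HB Require Import structures.
From mathcomp Require Import all_boot all_order all_algebra all_fingroup all_solvable.
From mathcomp Require Import all_classical all_reals all_analysis.
From mathcomp Require Import complex.
Set Implicit Arguments. Unset Strict Implicit. Unset Printing Implicit Defensive.
Import Order.TTheory GRing.Theory Num.Theory.
Import numFieldTopology.Exports numFieldNormedType.Exports.
Local Open Scope ring_scope.

Definition oddprimes (n : nat) : seq nat := [seq p <- primes n | odd p].

Definition squarefree (D : nat) : Prop := forall d : nat, (1 < d)%N -> ~~ (d * d %| D)%N.

(* Legendre symbol (k/p) for an odd prime p not dividing k *)
Definition legendre (k p : nat) : int :=
  if [exists x : 'I_p, (x * x %% p == k %% p)%N] then 1 else -1.

Definition sym4 (k : nat) : int := if (k %% 4 == 1)%N then 1 else -1.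

Definition chi8 (k : nat) : int :=
  if ((k %% 8 == 1) || (k %% 8 == 7))%N then 1 else -1.

Definition pstar (p : nat) : int := (-1) ^+ (p.-1./2) * (p : int).

Definition adm_witness (n1 : nat) (Delta : int) (w0 w : bool) (wf : nat -> bool) : Prop :=
  [/\ (w0 -> 3 <= logn 2 n1)%N, (w -> 2 <= logn 2 n1)%N &
      Delta = 2 ^+ w0 * (-1) ^+ w *
              \prod_(p <- oddprimes n1) (if wf p then pstar p else 1)].

Definition admissible (n1 : nat) (Delta : int) : Prop :=
  exists w0 w wf, adm_witness n1 Delta w0 w wf.

(* k in H_Delta  (k ranges over Z_{n1}^* represented by 0 <= k < n1, gcd(k,n1)=1).
   The witness of admissibility is unique, so the existential is harmless. *)
Definition inH (n1 : nat) (Delta : int) (k : nat) : Prop :=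
  [/\ (k < n1)%N, coprime k n1 &
      exists w0 w wf, adm_witness n1 Delta w0 w wf /\
        chi8 k ^+ w0 * sym4 k ^+ w *
        \prod_(p <- oddprimes n1) (if wf p then legendre k p else 1) = 1].

Definition expG (gT : finGroupType) : nat := exponent [set: gT].

Definition simD (gT : finGroupType) (Delta : int) (g h : gT) : Prop :=
  exists k, inH (expG gT) Delta k /\ exists x : gT, g = ((h ^+ k) ^ x)%g.

Definition union_of_sim (gT : finGroupType) (Delta : int) (C : {set gT}) : Prop :=
  forall g h : gT, simD Delta g h -> (g \in C) = (h \in C).

Definition conj_closed (gT : finGroupType) (C : {set gT}) : Prop :=
  forall x y : gT, x \in C -> (x ^ y)%g \in C.

Definition setinv (gT : finGroupType) (C : {set gT}) : {set gT} := [set (x^-1)%g | x in C].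
Definition setpow (gT : finGroupType) (C : {set gT}) (k : nat) : {set gT} :=
  [set (x ^+ k)%g | x in C].

(* the usual (norm) metric topology on C = R[i], exactly as MathComp-Analysis
   declares it for realType / rcfType in numFieldTopology *)
#[non_forgetful_inheritance]
HB.instance Definition _ (R : rcfType) := PseudoPointedMetric.copy R[i] R[i]^o.

Definition iC (R : rcfType) : R[i] := Complex 0 1.


Definition Amx (R : rcfType) (gT : finGroupType) (g : gT) : 'M[R[i]]_#|gT| :=
  \matrix_(a, b) ((enum_val b * (enum_val a)^-1 == g)%g)%:R.

Definition AmxC (R : rcfType) (gT : finGroupType) (C : {set gT}) : 'M[R[i]]_#|gT| :=
  \sum_(g in C) Amx R g.

Definition mixedM (R : rcfType) (gT : finGroupType) (Ci C1 Cm1 : {set gT}) : 'M[R[i]]_#|gT| :=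
  iC R *: AmxC R Ci - iC R *: AmxC R (setinv Ci) + AmxC R C1 - AmxC R Cm1.

Definition mxpow (K : numFieldType) (n : nat) (M : 'M[K]_n) (k : nat) : 'M[K]_n :=
  iter k (mulmx M) 1%:M.

Definition expSeries (R : realType) (n : nat) (M : 'M[R[i]]_n) (t : R) : nat -> 'M[R[i]]_n :=
  series (fun k => ((iC R * (t%:C)%C) ^+ k / (k`!)%:R) *: mxpow M k).

Definition periodic_walk (R : realType) (n : nat) (M : 'M[R[i]]_n) : Prop :=
  exists t : R, t != 0 /\ exists gamma : R[i],
    (expSeries M t @ \oo --> (gamma%:M : 'M[R[i]]_n))%classic.

(* Main.v *)
(** The mode [cmode f i = sum_g f g * chi_i g / chi_i 1] of the weight [f] of the
    arcs is an eigenvalue of [M]: by the generalized orthogonality relations each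
    right translate of an irreducible character is an eigenvector, and these
    translates span.  Write [exp(itM) = gamma I].  The eigenvalues then differ by
    integer multiples of [2 pi / t]; as the trace of [M] vanishes, each of them is
    a rational multiple of one real number, whose square is rational because the
    trace of [M ^ 2] is an integer.  Hence periodicity amounts to all modes lying
    in Q sqrt(D) for a single positive square-free [D].

    Complex conjugation of the characters separates the part of a mode coming from
    [C(i)], which without its factor i has to lie in Q sqrt(-D), from the part
    coming from [C(1)] and [C(-1)], which has to lie in Q sqrt(D). An
    automorphism acting on the roots of unity as [z |-> z ^ k] permutes the
    modes like [g |-> g ^ k] permutes the group, so all modes of an integer
    class function [c] lie in Q sqrt(Delta) iff [c (g ^ k) = +- c g], the sign
    being that by which the automorphism acts on sqrt(Delta). Gauss sums
    compute this sign: for [Delta] admissible it is the product of quadratic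
    symbols defining [H_Delta], and for [Delta] not admissible some
    automorphism fixing the roots of unity of order dividing the exponent
    changes the sign of sqrt(Delta). *)

Require Import Defs.
From HB Require Import structures.
From mathcomp Require Import all_boot all_order all_algebra all_fingroup all_solvable.
From mathcomp Require Import all_field all_character.
From mathcomp Require Import all_classical all_reals all_analysis.
From mathcomp Require Import complex.
From mathcomp Require Import ring lra.
Set Implicit Arguments. Unset Strict Implicit. Unset Printing Implicit Defensive.
Import Order.TTheory GRing.Theory Num.Theory.
Import numFieldTopology.Exports numFieldNormedType.Exports.
Local Open Scope ring_scope.

(** * Quadratic Gauss sums *)

Section Gauss.
Variable p : nat.
Hypotheses (p_pr : prime p) (p_odd : odd p).
Let m := p.-1./2.

Lemma half_primeK : (m.*2 = p.-1)%N.
Proof. by rewrite /m -(odd_double_half p) p_odd add1n /= doubleK. Qed.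

Lemma Fp_fermat (x : 'F_p) : x != 0 -> x ^+ p.-1 = 1.
Proof.
move=> x0; apply: (mulfI x0); rewrite -exprS prednK ?prime_gt0 // mulr1.
by rewrite -{2}(expf_card x) card_Fp.
Qed.

(** Squares have [m]-th power 1 by Fermat. Conversely, if x is the i-th power of a generator of the
    nonzero residues, then p - 1 = 2 m divides i m, so i is even. *)
Lemma euler_criterion (x : 'F_p) : x != 0 ->
  [exists y : 'F_p, y * y == x] = (x ^+ m == 1).
Proof.
move=> x0; apply/existsP/eqP => [[y /eqP yx]|xm].
  rewrite -yx -expr2 -exprM mul2n half_primeK Fp_fermat //.
  by apply: contraNneq x0 => y0; rewrite -yx y0 mul0r.
have p1 : (0 < p.-1)%N by rewrite -ltnS prednK ?prime_gt0 ?prime_gt1.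
have: has p.-1.-primitive_root [seq y <- enum 'F_p | y != 0].
  apply: has_prim_root => //.
  - by apply/allP=> y; rewrite mem_filter => /andP[y0 _]; apply/unity_rootP/Fp_fermat.
  - by rewrite filter_uniq // enum_uniq.
  - have <- : #|[pred y : 'F_p | y != 0]| = p.-1 by rewrite (cardC1 (0 : 'F_p)) card_Fp.
    by rewrite cardE {1}/enum_mem enumT.
case/hasP => z _ zp.
have [[i /= _] xi] := prim_rootP zp (Fp_fermat x0).
have : (p.-1 %| i * m)%N by rewrite (prim_order_dvd zp) exprM -xi xm.
rewrite -half_primeK -muln2 mulnC dvdn_pmul2r; last by rewrite -double_gt0 half_primeK.
case/dvdnP => j ij; exists (z ^+ j).
by rewrite xi ij -exprD addnn muln2.
Qed.

Lemma euler_pm1 (x : 'F_p) : x != 0 -> x ^+ m != 1 -> x ^+ m = -1.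
Proof.
move=> x0; have := Fp_fermat x0; rewrite -half_primeK -muln2 exprM => /eqP.
by rewrite sqrf_eq1 => /orP[->//|/eqP].
Qed.

Lemma Fp_neq0 (k : nat) : coprime k p -> k%:R != 0 :> 'F_p.
Proof. by rewrite -(dvdn_pcharf (pchar_Fp p_pr)) coprime_sym prime_coprime. Qed.

Lemma coprime2p : coprime 2 p. Proof. by rewrite coprime2n. Qed.

Lemma Fp_neq1N : (1 : 'F_p) != -1.
Proof. by rewrite -subr_eq0 opprK -[1 + 1]/(2%:R) Fp_neq0 // coprime2p. Qed.

(** The Legendre symbol in the form given by the Euler criterion; at 0 it takes the junk value
    -1. *)
Definition quad_char (c : 'F_p) : int := if c ^+ m == 1 then 1 else -1.

Lemma sqrt_count (y : 'F_p) : y != 0 -> #|[pred x : 'F_p | x * x == y * y]| = 2%N.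
Proof.
move=> y0; rewrite (eq_card (B := pred2 y (- y))) => [|x].
  rewrite card2; suff -> : y != - y by [].
  by rewrite -subr_eq0 opprK -mulr2n -mulr_natl mulf_neq0 // Fp_neq0 // coprime2p.
by rewrite !inE -!expr2 eqf_sqr.
Qed.

(** For nonzero z exactly one of z and z / k is a square, and it has two roots; 0 is reached once by
    each of the two maps. *)
Lemma count_sqr_nonsqr (k z : 'F_p) : k != 0 -> k ^+ m != 1 ->
  (#|[pred x : 'F_p | x * x == z]%R| + #|[pred x : 'F_p | k * (x * x) == z]%R| = 2)%N.
Proof.
move=> k0 km; have [->|z0] := eqVneq z 0.
  rewrite (eq_card (B := pred1 0)) => [|x]; last by rewrite !inE mulf_eq0 orbb.
  rewrite [X in (_ + X)%N](eq_card (B := pred1 0)) => [|x]; first by rewrite !card1.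
  by rewrite !inE !mulf_eq0 (negPf k0) orbb.
have card0 (P : pred 'F_p) : ~~ [exists x, P x] -> #|P| = 0%N.
  by rewrite negb_exists => /forallP P0; apply: eq_card0 => x; apply/negbTE/P0.
have kz (x : 'F_p) : (k * (x * x) == z) = (x * x == k^-1 * z).
  by rewrite -(inj_eq (mulfI (invr_neq0 k0))) mulKf.
have kz0 : k^-1 * z != 0 by rewrite mulf_neq0 ?invr_eq0.
rewrite (eq_card (A := [pred x | k * (x * x) == z]) (B := [pred x | x * x == k^-1 * z]));
  last by move=> x; rewrite !inE kz.
have [zm|zm] := boolP (z ^+ m == 1).
  have := euler_criterion z0; rewrite zm => /existsP[y /eqP yz].
  rewrite -{1}yz sqrt_count; last by apply: contraNneq z0 => y0; rewrite -yz y0 mul0r.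
  rewrite card0 // euler_criterion // exprMn exprVn (eqP zm) mulr1 (euler_pm1 k0 km).
  by rewrite invrN1 eq_sym Fp_neq1N.
rewrite card0 ?euler_criterion // add0n.
have := euler_criterion kz0.
rewrite exprMn exprVn (euler_pm1 k0 km) (euler_pm1 z0 zm) mulVf ?oppr_eq0 ?oner_eq0 // eqxx.
move=> /existsP[y /eqP yz]; rewrite -yz sqrt_count //.
by apply: contraNneq kz0 => y0; rewrite -yz y0 mul0r.
Qed.

Variable z : algC.
Hypothesis z_prim : p.-primitive_root z.

(** The additive character of the prime field attached to [z]. *)
Definition eFp (x : 'F_p) : algC := z ^+ x.

Lemma eFp_nat k : eFp k%:R = z ^+ k.
Proof. by rewrite /eFp val_Fp_nat // (prim_expr_mod z_prim). Qed.

Lemma eFp0 : eFp 0 = 1. Proof. by rewrite (eFp_nat 0). Qed.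

Lemma eFpD x y : eFp (x + y) = eFp x * eFp y.
Proof. by rewrite -[x]natr_Zp -[y]natr_Zp -natrD !eFp_nat exprD. Qed.

Lemma eFpM k x : eFp (k%:R * x) = eFp x ^+ k.
Proof. by rewrite -[x]natr_Zp -natrM !eFp_nat -exprM mulnC. Qed.

Lemma eFp_unity x : eFp x ^+ p = 1.
Proof. by rewrite -exprM mulnC exprM (prim_expr_order z_prim) expr1n. Qed.

Lemma eFp_conj x : (eFp x)^* = eFp (- x).
Proof.
have exN : eFp x * eFp (- x) = 1 by rewrite -eFpD subrr eFp0.
have ex0 : eFp x != 0 by apply: contra_eq_neq exN => ->; rewrite mul0r eq_sym oner_eq0.
apply: (mulfI ex0); rewrite exN -normCK.
suff /eqP -> : `|eFp x| == 1 by rewrite expr1n.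
by rewrite -(pexpr_eq1 (prime_gt0 p_pr)) // -normrX eFp_unity normr1.
Qed.

Lemma sum_eFp : \sum_x eFp x = 0.
Proof.
have e1 : eFp 1 != 1.
  rewrite -[1%R]/(1%:R) eFp_nat -(prim_order_dvd z_prim) dvdn1 neq_ltn prime_gt1 ?orbT //.
apply/eqP; have : (eFp 1 - 1) * (\sum_x eFp x) == 0.
  rewrite mulrBl mul1r subr_eq0 mulr_sumr [X in _ == X](reindex_inj (addrI 1)) /=.
  by apply/eqP/eq_bigr => x _; rewrite eFpD.
by rewrite mulf_eq0 subr_eq0 (negPf e1).
Qed.

Lemma sum_eFpM c : \sum_x eFp (c * x) = (c == 0)%:R * p%:R.
Proof.
have [->|c0] := eqVneq c 0.
  under eq_bigr => x _ do rewrite mul0r eFp0.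
  by rewrite sumr_const card_Fp // mul1r.
by rewrite mul0r -[RHS]sum_eFp [RHS](reindex_inj (mulfI c0)).
Qed.

Definition gauss := \sum_x eFp (x * x).

(** The substitution x |-> x + y linearizes x^2 - y^2 in y. *)
Lemma gauss_conj_mul : gauss * gauss^* = p%:R.
Proof.
rewrite mulrC {1}/gauss rmorph_sum mulr_suml.
transitivity (\sum_y \sum_x eFp (x * x) * eFp (2%:R * x * y)).
  apply: eq_bigr => y _; rewrite /= eFp_conj /gauss mulr_sumr (reindex_inj (addIr y)) /=.
  by apply: eq_bigr => x _; rewrite -!eFpD; congr eFp; ring.
rewrite exchange_big /= (bigD1 0) //= [X in _ + X]big1 => [|x x0].
  by rewrite addr0 -mulr_sumr sum_eFpM !mulr0 eFp0 eqxx !mul1r.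
rewrite -mulr_sumr sum_eFpM mulf_eq0 (negPf x0) orbF.
by rewrite (negPf (Fp_neq0 _)) ?mul0r ?mulr0 // coprime2p.
Qed.

(** A square factor k = y y is absorbed by x |-> y x. For a nonsquare, [count_sqr_nonsqr] shows that
    the two sums add up to twice the sum of the additive character, which vanishes. *)
Lemma gauss_twist (k : 'F_p) : k != 0 ->
  \sum_x eFp (k * (x * x)) = (quad_char k)%:~R * gauss.
Proof.
move=> k0; rewrite /quad_char; case: ifPn => [km|km].
  have := euler_criterion k0; rewrite km => /existsP[y /eqP yk].
  have y0 : y != 0 by apply: contraNneq k0 => y0; rewrite -yk y0 mul0r.
  rewrite mul1r /gauss [RHS](reindex_inj (mulfI y0)) /=.
  by apply: eq_bigr => x _; rewrite -yk; congr eFp; ring.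
rewrite mulrN1z mulN1r; apply/eqP; rewrite -addr_eq0 addrC /gauss.
have fib (F : 'F_p -> 'F_p) : \sum_x eFp (F x) = \sum_z #|[pred x | F x == z]|%:R * eFp z.
  rewrite (partition_big F predT) //=; apply: eq_bigr => w _.
  by rewrite mulr_natl -sumr_const; apply: eq_big => [x|x /eqP ->]; rewrite ?inE.
rewrite !fib -big_split /=; under eq_bigr => w _.
  rewrite -mulrDl -natrD (count_sqr_nonsqr w k0 km); over.
by rewrite -mulr_sumr sum_eFp mulr0.
Qed.

(** Conjugation is the twist by -1, so the square differs from the known product with the conjugate
    by the symbol of -1. *)
Lemma gauss_sqr : gauss ^+ 2 = ((-1) ^+ m * (p : int))%:~R.
Proof.
have gJ : gauss^* = ((-1) ^+ m)%:~R * gauss.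
  have -> : (-1) ^+ m = quad_char (-1).
    rewrite /quad_char -(signr_odd int) -(signr_odd 'F_p); case: (odd m).
      by rewrite !expr1 eq_sym (negPf Fp_neq1N).
    by rewrite !expr0 eqxx.
  rewrite -gauss_twist ?oppr_eq0 ?oner_eq0 // rmorph_sum /=.
  by apply: eq_bigr => x _; rewrite eFp_conj mulN1r.
rewrite rmorphM /= -[(p : int)%:~R]/(p%:R) -gauss_conj_mul gJ.
by rewrite mulrCA (mulrA _ _ gauss) -rmorphM /= -expr2 sqrr_sign mul1r.
Qed.

Lemma gauss_aut (u : {rmorphism algC -> algC}) k : coprime k p ->
  (forall w, w ^+ p = 1 -> u w = w ^+ k) -> u gauss = (quad_char k%:R)%:~R * gauss.
Proof.
move=> kp uk; rewrite -gauss_twist ?Fp_neq0 // rmorph_sum /=.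
by apply: eq_bigr => x _; rewrite uk ?eFp_unity // eFpM.
Qed.
End Gauss.

(** * Square roots of admissible integers *)

Lemma Fp_nat_eq p a b : prime p -> (a%:R == b%:R :> 'F_p) = (a %% p == b %% p)%N.
Proof. by move=> p_pr; rewrite -val_eqE /= !val_Fp_nat. Qed.

Lemma legendreE p k : prime p -> odd p -> coprime k p ->
  legendre k p = @quad_char p k%:R.
Proof.
move=> p_pr p_odd kp; rewrite /legendre /quad_char -euler_criterion ?Fp_neq0 //.
congr (if _ then _ else _); apply/existsP/existsP => -[x xk].
  by exists x%:R; rewrite -natrM Fp_nat_eq.
have xp : (x < p)%N by rewrite -[X in (_ < X)%N](Fp_cast p_pr).
by exists (Ordinal xp); rewrite -Fp_nat_eq // natrM /= natr_Zp.
Qed.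

Definition acts_as_power n (u : {rmorphism algC -> algC}) k :=
  forall z, z ^+ n = 1 -> u z = z ^+ k.

Lemma acts_as_power_dvd n d u k : (d %| n)%N -> acts_as_power n u k -> acts_as_power d u k.
Proof. by move=> /dvdnP[q ->] uk z z1; apply: uk; rewrite mulnC exprM z1 expr1n. Qed.

Lemma mem_oddprimes n p : (p \in oddprimes n) = [&& odd p, prime p, (0 < n)%N & (p %| n)%N].
Proof. by rewrite mem_filter mem_primes. Qed.

(** The root is a product of Gauss sums over the selected primes. The list is an arbitrary list of
    odd prime divisors of n, so that the induction keeps n fixed. *)
Lemma oddprimes_sqrt n (s : seq nat) (wf : nat -> bool) : {subset s <= oddprimes n} ->
  exists g : algC, g ^+ 2 = (\prod_(p <- s) (if wf p then pstar p else 1))%:~R /\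
  forall u k, coprime k n -> acts_as_power n u k ->
    u g = (\prod_(p <- s) (if wf p then legendre k p else 1))%:~R * g.
Proof.
elim: s => [|p s IHs] sn.
  by exists 1; rewrite big_nil expr1n; split=> // u k _ _; rewrite big_nil mul1r rmorph1.
have [|g [gg gu]] := IHs; first by move=> q qs; apply: sn; rewrite inE qs orbT.
have := sn p (mem_head _ _); rewrite mem_oddprimes => /and4P[p_odd p_pr n0 pn].
have [z zp] := C_prim_root_exists (prime_gt0 p_pr).
exists ((if wf p then gauss p z else 1) * g); split=> [|u k kn uk].
  rewrite big_cons exprMn gg rmorphM; congr (_ * _).
  by case: (wf p); rewrite ?expr1n //= gauss_sqr.
have kp : coprime k p by rewrite (coprime_dvdr pn).
rewrite big_cons !rmorphM (gu _ _ kn uk) /= mulrACA; congr (_ * _).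
case: (wf p); rewrite ?rmorph1 ?mulr1 //.
by rewrite legendreE // (gauss_aut (u := u) p_pr p_odd zp kp) //; apply: acts_as_power_dvd pn uk.
Qed.

Lemma sqrt2_aut : exists g : algC, g ^+ 2 = 2%:R /\
  forall u k, odd k -> acts_as_power 8 u k -> u g = (chi8 k)%:~R * g.
Proof.
have [z z8] := @C_prim_root_exists 8 isT.
have z4 : z ^+ 4 = -1.
  have := prim_expr_order z8; rewrite (_ : 8 = 4 * 2)%N // exprM => /eqP.
  by rewrite sqrf_eq1 -(prim_order_dvd z8) => /orP[//|/eqP].
(* This is z + z^-1; the power map z |-> z ^ k fixes it for k = 1, 7 modulo 8 and negates it for k =
   3, 5. *)
exists (z + z ^+ 7); split.
  have z8' : z ^+ 8 = 1 by apply: prim_expr_order.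
  have -> : (z + z ^+ 7) ^+ 2 = z ^+ 4 * z ^+ 8 * z ^+ 2 + 2%:R * z ^+ 8 + z ^+ 2 by ring.
  by rewrite z4 z8'; ring.
move=> u k k_odd uk; rewrite rmorphD rmorphXn /= (uk z (prim_expr_order z8)).
rewrite -exprM -(prim_expr_mod z8) -(prim_expr_mod z8 (k * 7)) -modnMml /chi8.
have : odd (k %% 8) by rewrite odd_mod.
have := ltn_pmod k (isT : 0 < 8)%N; move: (k %% 8)%N => [|[|[|[|[|[|[|[|//]]]]]]]] //= _ _.
- by rewrite mul1r.
- rewrite mulrN1z (_ : _ %% _ = 5)%N // -[5%N]/(4 + 1)%N -[7%N]/(4 + 3)%N !exprD z4; ring.
- rewrite mulrN1z (_ : _ %% _ = 3)%N // -[5%N]/(4 + 1)%N -[7%N]/(4 + 3)%N !exprD z4; ring.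
- by rewrite mul1r (_ : _ %% _ = 1)%N // addrC.
Qed.

Lemma sqrtN1_aut u k : odd k -> acts_as_power 4 u k -> u 'i = (sym4 k)%:~R * 'i.
Proof.
move=> k_odd uk.
have i4 : 'i ^+ 4 = 1 :> algC by rewrite -[4%N]/(2 * 2)%N exprM sqrCi sqrrN expr1n.
rewrite uk // /sym4 {1}(divn_eq k 4) exprD mulnC exprM i4 expr1n mul1r.
have : odd (k %% 4) by rewrite odd_mod.
have := ltn_pmod k (isT : 0 < 4)%N; move: (k %% 4)%N => [|[|[|[|//]]]] //= _ _.
  by rewrite mul1r.
by rewrite exprS sqrCi mulrN1 mulrN1z mulN1r.
Qed.

Definition symbol n (w0 w : bool) (wf : nat -> bool) k : int :=
  chi8 k ^+ w0 * sym4 k ^+ w *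
        \prod_(p <- oddprimes n) (if wf p then legendre k p else 1).

Lemma witness_sqrt n Delta w0 w wf : (0 < n)%N -> adm_witness n Delta w0 w wf ->
  forall s : algC, s ^+ 2 = Delta%:~R ->
  forall u k, coprime k n -> acts_as_power n u k -> u s = (symbol n w0 w wf k)%:~R * s.
Proof.
move=> n0 [h0 h1 ->] s ss.
have [g [gg gu]] := oddprimes_sqrt (n := n) wf (fun _ => id).
have [r2 [r2r r2u]] := sqrt2_aut.
pose t := r2 ^+ w0 * 'i ^+ w * g.
have tt : t ^+ 2 = s ^+ 2.
  rewrite ss !rmorphM !exprMn gg; congr (_ * _ * _); rewrite !rmorphXn exprAC; congr (_ ^+ _) => //.
  by rewrite sqrCi.
suff tu u k : coprime k n -> acts_as_power n u k -> u t = (symbol n w0 w wf k)%:~R * t.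
  move=> u k kn uk; have /eqP := tt; rewrite eqf_sqr => /orP[]/eqP ts.
    by rewrite -ts (tu _ k).
  by apply: oppr_inj; rewrite -rmorphN -mulrN -ts (tu _ k).
move=> kn uk; rewrite /t /symbol !rmorphM (gu _ _ kn uk) [RHS]mulrACA; congr (_ * _).
rewrite [RHS]mulrACA; congr (_ * _).
  case: w0 h0 {ss tt t} => [h|]; rewrite ?mul1r //; last by rewrite !expr0 !rmorph1 ?mulr1 ?mul1r.
  have n8 : (2 ^ 3 %| n)%N by rewrite pfactor_dvdn // h.
  rewrite expr1 (r2u u k) //; last exact: acts_as_power_dvd n8 uk.
  by rewrite -coprimen2; apply: coprime_dvdr kn; apply: dvdn_trans n8.
case: w h1 {ss tt t} => [h|]; rewrite ?mul1r //; last by rewrite !expr0 !rmorph1 ?mulr1 ?mul1r.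
have n4 : (2 ^ 2 %| n)%N by rewrite pfactor_dvdn // h.
rewrite expr1 (sqrtN1_aut (k := k)) //; last exact: acts_as_power_dvd n4 uk.
by rewrite -coprimen2; apply: coprime_dvdr kn; apply: dvdn_trans n4.
Qed.

(** * Sign changes of the square roots of non-admissible integers *)

Lemma crt_unit N q m0 a : (0 < N)%N -> prime q -> q.-nat m0 -> coprime a q ->
  (0 < m0)%N -> (q %| m0)%N ->
  exists k, [/\ k = a %[mod m0], k = 1 %[mod N`_(q^')%N] & coprime k N].
Proof.
move=> N0 q_pr qm aq m00 qm0.
have co : coprime m0 N`_(q^')%N by apply: pnat_coprime qm (part_pnat _ _).
exists (chinese m0 N`_(q^')%N a 1); set k := chinese _ _ _ _.
have k1 : k = a %[mod m0] by apply: chinese_modl.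
have k2 : k = 1 %[mod N`_(q^')%N] by apply: chinese_modr.
split=> //; rewrite -(partnC q N0) coprimeMr; apply/andP; split.
  rewrite p_part coprimeXr // -coprime_modl -(modn_dvdm k qm0) k1 modn_dvdm //.
  by rewrite coprime_modl.
by rewrite -coprime_modl k2 coprime_modl coprime1n.
Qed.

Lemma prod_over_divisors (F : nat -> int) D n : (0 < n)%N -> (0 < D)%N ->
  (forall p, p \in oddprimes D -> (p %| n)%N) ->
  \prod_(p <- oddprimes n) (if (p %| D)%N then F p else 1) = \prod_(p <- oddprimes D) F p.
Proof.
move=> n0 D0 Dn; rewrite -big_mkcond -big_filter; apply: perm_big; apply: uniq_perm.
- by rewrite filter_uniq // filter_uniq ?primes_uniq.
- by rewrite filter_uniq ?primes_uniq.
move=> p; rewrite mem_filter !mem_oddprimes n0 D0 /=.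
case p_odd : (odd p); case p_pr : (prime p); rewrite /= ?andbF //.
by have [pD|//] := boolP (p %| D)%N; rewrite Dn // mem_oddprimes p_odd p_pr D0.
Qed.

Lemma squarefree_prod D : (0 < D)%N -> squarefree D ->
  D = (2 ^ (2 %| D) * \prod_(p <- oddprimes D) p)%N.
Proof.
move=> D0 sqf.
have ->: (2 ^ (2 %| D) * \prod_(p <- oddprimes D) p = \prod_(p <- primes D) p)%N.
  rewrite [RHS](bigID odd) /= mulnC big_filter; congr (_ * _)%N.
  have [D2|D2] := boolP (2 %| D)%N; last first.
    rewrite big_seq_cond big1 // => p /andP[]; rewrite mem_primes => /and3P[p_pr _ pD] po.
    by case: (even_prime p_pr) po pD D2 => [-> _ ->|->].
  rewrite big_mkcond (bigD1_seq 2%N) ?primes_uniq ?mem_primes ?D0 //= big_seq_cond big1 ?muln1 // => p.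
  rewrite mem_primes => /andP[/and3P[p_pr _ pD] p2].
  by case: (even_prime p_pr) p2 => [->|->].
rewrite [LHS]prod_prime_decomp // prime_decompE big_map big_seq [RHS]big_seq.
apply: eq_bigr => p; rewrite mem_primes => /and3P[p_pr _ pD] /=.
suff -> : logn p D = 1%N by [].
apply/eqP; rewrite eqn_leq; apply/andP; split; last by rewrite -pfactor_dvdn.
by rewrite leqNgt -pfactor_dvdn // expnS expn1 sqf ?prime_gt1.
Qed.

(** Once 8 divides N, the factors 2 and -1 are both available, so that D and -D are both
    admissible. *)
Lemma squarefree_witness N D (Delta : int) : (0 < D)%N -> squarefree D -> (0 < N)%N ->
  (D %| N)%N -> (8 %| N)%N -> `|Delta|%N = D ->
  exists w, adm_witness N Delta (2 %| D)%N w (fun p => p %| D)%N.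
Proof.
move=> D0 sqf N0 DN N8 DeltaD.
have l3 : (3 <= logn 2 N)%N by rewrite -pfactor_dvdn.
have l2 : (2 <= logn 2 N)%N by apply: leq_trans l3.
pose e := \prod_(p <- oddprimes D) ((-1) ^+ (p.-1./2) : int).
have [b eb] : exists b : bool, e = (-1) ^+ b.
  rewrite /e; elim/big_ind: _ => [|x y [b ->] [c ->]|p _].
  - by exists false.
  - by exists (b (+) c); rewrite signr_addb.
  - by exists (odd p.-1./2); rewrite signr_odd.
have Dprod : (D : int) = 2 ^+ (2 %| D)%N * \prod_(p <- oddprimes D) (p : int).
  rewrite {1}(squarefree_prod D0 sqf) PoszM (big_morph Posz PoszM (erefl (1 : int))).
  by case: (2 %| D)%N.
(* The factor -1 is used exactly when the sign of Delta differs from the sign (-1)^b of the product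
   of the [pstar p]. *)
exists ((Delta < 0) (+) b); split => //.
rewrite prod_over_divisors //; last first.
  by move=> p; rewrite mem_oddprimes => /and4P[_ _ _ pD]; apply: dvdn_trans DN.
rewrite big_split /= -/e eb signr_addb {1}(intEsign Delta) DeltaD Dprod.
have := sqrr_sign int b; set c := (-1) ^+ b => cc.
transitivity ((-1) ^+ (Delta < 0)%R * (2 ^+ (2 %| D)%N * \prod_(p <- oddprimes D) (p : int)) * c ^+ 2).
  by rewrite cc mulr1.
by ring.
Qed.

(** Squaring identifies 1 and -1; not being injective on a finite set, it is not surjective
    either. *)
Lemma nonresidue_exists p : prime p -> odd p -> exists2 a, coprime a p & legendre a p = -1.
Proof.
move=> p_pr p_odd.
have [inj|] := boolP (injectiveb (fun x : 'F_p => x * x)).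
  have : (1 : 'F_p) = -1 by apply: (injectiveP _ inj); rewrite mulrNN.
  by move/eqP; rewrite (negPf (Fp_neq1N p_pr p_odd)).
move=> ninj; have [surj|] := boolP [forall c : 'F_p, exists y : 'F_p, y * y == c].
  case/negP: ninj; apply/injectiveP.
  have /canF_sym/can_inj// : cancel (fun c => odflt 0 [pick y : 'F_p | y * y == c]) (fun x => x * x).
  move=> c; case: pickP => [y /eqP //|nc].
  by have /existsP[y] := forallP surj c; rewrite nc.
rewrite negb_forall => /existsP[c cns].
have c0 : c != 0.
  by apply: contraNneq cns => ->; apply/existsP; exists 0; rewrite mul0r.
have cp : coprime c p.
  by rewrite coprime_sym prime_coprime // (dvdn_pcharf (pchar_Fp p_pr)) natr_Zp.
exists c => //; rewrite legendreE // natr_Zp /quad_char -euler_criterion //.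
by rewrite (negPf cns).
Qed.

Lemma dvdn_part_compl N q d : (0 < N)%N -> (d %| N)%N -> coprime q d -> (d %| N`_(q^')%N)%N.
Proof.
move=> N0 dN qd; rewrite -(@Gauss_dvdr d (N`_q)%N) ?partnC //.
by rewrite p_part coprimeXr // coprime_sym.
Qed.

Lemma legendre_mod a b p : a = b %[mod p] -> legendre a p = legendre b p.
Proof. by rewrite /legendre => ->. Qed.

Lemma legendre1 p : prime p -> legendre 1 p = 1.
Proof.
move=> p_pr; rewrite /legendre ifT //; apply/existsP.
by exists (Ordinal (prime_gt1 p_pr)).
Qed.

Lemma chi8_mod a b : a = b %[mod 8] -> chi8 a = chi8 b.
Proof. by rewrite /chi8 => ->. Qed.

Lemma sym4_mod a b : a = b %[mod 4] -> sym4 a = sym4 b.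
Proof. by rewrite /sym4 => ->. Qed.

Lemma modn_trans d m a b : (d %| m)%N -> a = b %[mod m] -> a = b %[mod d].
Proof. by move=> dm ab; rewrite -(modn_dvdm a dm) ab modn_dvdm. Qed.

(** Non-admissibility has two possible causes: an odd prime divisor of D does not divide n, or n
    contains too small a power of 2. The exponent k is 1 away from the prime at fault and makes the
    symbol -1 there. *)
Lemma symbol_nontrivial n D (Delta : int) w : (0 < n)%N -> (0 < D)%N -> squarefree D ->
  `|Delta|%N = D -> ~ admissible n Delta ->
  let N := (8 * D * n)%N in let wf p := (p %| D)%N in
  adm_witness N Delta (2 %| D)%N w wf ->
  exists k, [/\ coprime k N, k = 1 %[mod n] & symbol N (2 %| D)%N w wf k = -1].
Proof.
move=> n0 D0 sqf DeltaD nadm N wf [_ _ wit].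
have N0 : (0 < N)%N by rewrite !muln_gt0 D0 n0.
have nN : (n %| N)%N by apply: dvdn_mull.
have N8 : (8 %| N)%N by rewrite /N -mulnA dvdn_mulr.
have [/hasP[p]|] := boolP (has (fun p => ~~ (p %| n)%N) (oddprimes D)).
  rewrite mem_oddprimes => /and4P[p_odd p_pr _ pD pn].
  have [a ap la] := nonresidue_exists p_pr p_odd.
  have [k [k1 k2 kN]] := crt_unit N0 p_pr (pnat_id p_pr) ap (prime_gt0 p_pr) (dvdnn p).
  have cop d : (d %| N)%N -> coprime p d -> k = 1 %[mod d].
    by move=> dN pd; apply: modn_trans k2; apply: dvdn_part_compl.
  exists k; split=> //; first by apply: cop => //; rewrite prime_coprime.
  have k8 : k = 1 %[mod 8] by apply: cop => //; rewrite -[8%N]/(2 ^ 3)%N coprimeXr // coprime_sym coprime2n.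
  have k4 : k = 1 %[mod 4] by apply: (@modn_trans 4 8).
  rewrite /symbol (chi8_mod k8) (sym4_mod k4) !expr1n !mul1r.
  have pN : p \in oddprimes N by rewrite mem_oddprimes p_odd p_pr N0 (dvdn_trans pD) // /N mulnAC dvdn_mull.
  rewrite (bigD1_seq p) ?filter_uniq ?primes_uniq //= /wf pD (legendre_mod k1) la.
  rewrite big_seq_cond big1 ?mulr1 // => q /andP[]; rewrite mem_oddprimes => /and4P[_ q_pr _ qN] qp.
  case: ifP => // _; rewrite (@legendre_mod k 1) ?legendre1 //; apply: cop => //.
  by rewrite prime_coprime // dvdn_prime2 // eq_sym.
rewrite -all_predC => /allP Dn.
have Dn' p : p \in oddprimes D -> (p %| n)%N by move/Dn; rewrite /= negbK.
(* 7 changes the sign of sqrt(-1) but not of sqrt(2), and 5 that of sqrt(2) but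
   not of sqrt(-1). *)
have [r [r0 n4 r1 r2]] : exists r, [/\ odd r, (n`_2 %| 4)%N, r = 1 %[mod (n`_2)%N] &
    chi8 r ^+ (2 %| D)%N * sym4 r ^+ w = -1].
  have n2 e : (logn 2 n <= e)%N -> (n`_2 %| 2 ^ e)%N by move=> ne; rewrite p_part dvdn_exp2l.
  have [w1|w1] := boolP (w && (logn 2 n < 2)%N).
    have /andP[-> n1] := w1.
    exists 7%N; split=> //.
    - exact: dvdn_trans (n2 1%N n1) _.
    - by apply: (@modn_trans _ 2) => //; exact: (n2 1%N).
    by case: (2 %| D)%N.
  have [w0|w0] := boolP ((2 %| D)%N && (logn 2 n < 3)%N).
    have /andP[-> n1] := w0.
    exists 5%N; split=> //.
    - exact: (n2 2%N).
    - by apply: (@modn_trans _ 4) => //; exact: (n2 2%N).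
    by case: (w).
  (* With no obstruction at 2 or at an odd prime, the witness for N is one for n. *)
  case: nadm; exists (2 %| D)%N, w, wf; split.
  - by move=> h; move: w0; rewrite h /= -leqNgt.
  - by move=> h; move: w1; rewrite h /= -leqNgt.
  - rewrite wit !prod_over_divisors // => p; rewrite mem_oddprimes => /and4P[_ _ _ pD].
    by rewrite (dvdn_trans pD) // /N mulnAC dvdn_mull.
have [||k [k1 k2 kN]] := @crt_unit N 2 8 r N0 isT _ _ isT isT.
- by [].
- by rewrite coprimen2.
exists k; split=> //.
  have co : coprime (n`_2)%N (n`_(2^'))%N by rewrite p_part coprimeXl // coprime2n odd_2'nat part_pnat.
  suff : k == 1 %[mod (n`_2)%N * (n`_(2^'))%N] by rewrite partnC // => /eqP.
  rewrite chinese_remainder //; apply/andP; split; apply/eqP.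
    by rewrite -r1; apply: modn_trans k1; exact: dvdn_trans n4 _.
  apply: modn_trans k2; apply: dvdn_part_compl => //.
    by apply: dvdn_trans nN; exact: dvdn_part.
  by rewrite coprime2n odd_2'nat part_pnat.
have k4 : k = r %[mod 4] by apply: (@modn_trans 4 8).
rewrite /symbol (chi8_mod k1) (sym4_mod k4) r2 big_seq_cond big1 ?mulr1 // => p.
rewrite andbT mem_oddprimes => /and4P[p_odd p_pr _ pN]; case: ifP => // _.
rewrite (@legendre_mod k 1) ?legendre1 //; apply: modn_trans k2.
by apply: dvdn_part_compl => //; rewrite coprime2n.
Qed.

(** Delta becomes admissible for the larger exponent N = 8 D n, where the sign of an automorphism on
    [s] can be read from the symbol. *)
Lemma nonadmissible_aut n D (Delta : int) : (0 < n)%N -> (0 < D)%N -> squarefree D ->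
  `|Delta|%N = D -> ~ admissible n Delta ->
  forall s : algC, s ^+ 2 = Delta%:~R -> exists u, acts_as_power n u 1 /\ u s = - s.
Proof.
move=> n0 D0 sqf DeltaD nadm s ss; set N := (8 * D * n)%N.
have N0 : (0 < N)%N by rewrite !muln_gt0 D0 n0.
have [||w wit] := @squarefree_witness N D Delta D0 sqf N0 _ _ DeltaD.
- by rewrite /N mulnAC dvdn_mull.
- by rewrite /N -mulnA dvdn_mulr.
have [k [kN k1 sk]] := symbol_nontrivial n0 D0 sqf DeltaD nadm wit.
have [u uk] := Qn_aut_exists kN.
exists u; split=> [z zn|]; last by rewrite (witness_sqrt N0 wit ss kN uk) sk mulN1r.
rewrite uk; last by rewrite /N mulnC exprM zn expr1n.
by rewrite -(expr_mod _ zn) k1 expr_mod.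
Qed.

(** Galois description of H_Delta: the exponents of the automorphisms fixing sqrt(Delta). It makes
    membership independent of the witness and of the automorphism chosen for k. *)
Lemma inH_fixes n (Delta : int) k u (s : algC) : (0 < n)%N -> admissible n Delta ->
  Delta != 0 -> s ^+ 2 = Delta%:~R -> (k < n)%N -> coprime k n -> acts_as_power n u k ->
  inH n Delta k <-> u s = s.
Proof.
move=> n0 [w0 [w [wf wit]]] D0 ss kn ck uk.
have s0 : s != 0 by apply: contraNneq D0 => s0; move: ss; rewrite s0 expr0n => /eqP; rewrite eq_sym intr_eq0.
split=> [[_ _ [v0 [v [vf [vit vk]]]]]|us].
  by rewrite (witness_sqrt n0 vit ss ck uk) /symbol vk mul1r.
split=> //; exists w0, w, wf; split=> //.
have := witness_sqrt n0 wit ss ck uk; rewrite us -{1}[s]mul1r => /(mulIf s0)/eqP.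
by rewrite -[1]/(1%:~R) eqr_int => /eqP.
Qed.

(** * Rationality by Galois invariance *)

(** The splitting field of the minimal polynomial of x is Galois over Q and each of its
    automorphisms extends to algC, so x lies in the fixed field Q. *)
Lemma algC_fixed_rat (x : algC) :
  (forall u : {rmorphism algC -> algC}, u x = x) -> x \in Crat.
Proof.
move=> ux.
have [r Dp] := closed_field_poly_normal (minCpoly x).
rewrite (monicP (minCpoly_monic x)) scale1r in Dp.
have [p [pE _] _] := minCpolyP x.
have [Qn [QnC [s Ds genQn]]] := num_field_exists r.
have Dpn : map_poly (in_alg Qn) p = \prod_(y <- s) ('X - y%:P).
  apply: (map_poly_inj QnC); rewrite rmorph_prod /= -map_poly_comp.
  rewrite (eq_map_poly (fmorph_eq_rat (QnC \o in_alg Qn))) -pE Dp -Ds big_map.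
  by apply: eq_bigr => i _; rewrite map_polyXsubC.
have split_p : splittingFieldFor 1 (map_poly (in_alg Qn) p) {:Qn}.
  by exists s; rewrite ?Dpn ?eqpxx.
have p_over : (map_poly (in_alg Qn) p) \is a polyOver 1%AS.
  by apply/polyOverP => i; rewrite coef_map /= memvZ // mem1v.
have Qn_ax : FieldExt_isSplittingField _ Qn by constructor; exists (map_poly (in_alg Qn) p).
pose K := HB.pack_for (splittingFieldType rat) Qn Qn_ax.
have galK : galois 1 {:K}.
  rewrite /galois sub1v normalFieldf andbT /=.
  apply/separableP => y _; apply: pcharf0_separable => i.
  by rewrite -(fmorph_pchar QnC) pchar_num.
have xr : x \in r by rewrite -root_prod_XsubC -Dp root_minCpoly.
have [y yx] : exists y : K, QnC y = x.
  by move: xr; rewrite -Ds => /mapP[y _ ->]; exists y.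
have : y \in fixedField 'Gal({:K} / 1)%g.
  apply/fixedFieldP; first exact: memvf.
  move=> nu _; have [u uE] := extend_algC_subfield_aut (QnC : {rmorphism K -> algC}) nu.
  by apply: (fmorph_inj QnC); rewrite -/K (uE y) yx ux.
rewrite (galois_fixedField _ ) // => /vlineP[a ya].
by rewrite -yx ya /= alg_num_field fmorph_rat; apply/CratP; exists a.
Qed.

Lemma aut_acts_as_power n (u : {rmorphism algC -> algC}) : (0 < n)%N ->
  exists k, [/\ (k < n)%N, coprime k n & acts_as_power n u k].
Proof.
move=> n0; have [z zp] := C_prim_root_exists n0.
have uzp : n.-primitive_root (u z) by rewrite fmorph_primitive_root.
have [[k kn] /= uz] := prim_rootP zp (prim_expr_order uzp).
exists k; split=> //; first by move: uzp; rewrite uz prim_root_exp_coprime.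
move=> w /(prim_rootP zp)[j ->]; by rewrite rmorphXn /= uz exprAC.
Qed.

(** * Modes of class functions and the Galois action on them *)

Section ClassFunctions.
Variable gT : finGroupType.
Local Notation G := [set: gT]%G.
Local Notation n := (expG gT).
Implicit Types (f : gT -> algC) (c : gT -> int).

Definition is_class (T : Type) (f : gT -> T) := forall x y : gT, f (x ^ y)%g = f x.

Definition chr (i : Iirr G) (x : gT) : algC := 'chi_i x.

Definition cmode f (i : Iirr G) : algC := (\sum_g f g * chr i g) / chr i 1%g.

Lemma expG_gt0 : (0 < n)%N. Proof. exact: exponent_gt0. Qed.

Lemma expgG (g : gT) : (g ^+ n = 1)%g. Proof. by apply: expg_exponent; rewrite inE. Qed.

Lemma expg_inverseK k k' (g : gT) : (k * k' = 1 %[mod n])%N -> (g ^+ (k * k') = g)%g.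
Proof. by move=> kk'; rewrite -(expg_mod _ (expgG g)) kk' (expg_mod _ (expgG g)). Qed.

Lemma chr1_gt0 i : 0 < chr i 1%g. Proof. exact: irr1_gt0. Qed.

Lemma chr1_neq0 i : chr i 1%g != 0. Proof. exact: irr1_neq0. Qed.

(** After expansion of f in irreducible characters, the generalized orthogonality relations keep
    only the term of [i]. The expansion is that of g |-> f (g^-1), since these relations pair one
    character with the inverse argument of the other. *)
Lemma chr_eigen f i x : is_class f ->
  \sum_g f g * chr i (g * x)%g = cmode f i * chr i x.
Proof.
move=> f_class; have clF : is_class_fun <<G>>%g [ffun g => f g^-1%g].
  apply: intro_class_fun => [y z _ _|y]; last by rewrite /= genGid finset.inE.
  by rewrite -conjVg f_class.
pose F : 'CF(G) := Cfun 0 clF.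
have FE g : f g = \sum_j '[F, 'chi_j] * chr j g^-1%g.
  have := congr1 (fun h : 'CF(G) => h g^-1%g) (cfun_sum_cfdot F).
  rewrite sum_cfunE; under eq_bigr => j _ do rewrite cfunE.
  by rewrite cfunE invgK.
have key y : \sum_g f g * chr i (g * y)%g = '[F, 'chi_i] * #|G|%:R / chr i 1%g * chr i y.
  under eq_bigr => g _ do rewrite FE mulr_suml.
  rewrite exchange_big /= (bigD1 i) //= [X in _ + X]big1 ?addr0 => [|j ji].
    have := generalized_orthogonality_relation y i i; rewrite eqxx mul1r.
    move=> /(congr1 (fun t => '[F, 'chi_i] * #|G|%:R * t)); rewrite mulrA mulfK ?neq0CG //.
    rewrite mulr_sumr => E; rewrite -[RHS]mulrA (mulrC _^-1) -E; apply: eq_big => [g|g _]; rewrite ?inE //.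
    by rewrite -mulrA (mulrC (chr i _)).
  have := generalized_orthogonality_relation y i j; rewrite eq_sym (negPf ji) mul0r.
  move/eqP; rewrite mulf_eq0 invr_eq0 (negPf (neq0CG _)) /= => /eqP E.
  rewrite -[RHS](mulr0 '[F, 'chi_j]) -[X in _ = _ * X]E mulr_sumr; apply: eq_big => [g|g _]; rewrite ?inE //.
  by rewrite -mulrA (mulrC (chr j _)).
have -> : cmode f i = '[F, 'chi_i] * #|G|%:R / chr i 1%g.
  rewrite /cmode; have := key 1%g; under eq_bigr => g _ do rewrite mulg1.
  by move=> ->; rewrite mulfK ?chr1_neq0.
exact: key.
Qed.

Lemma chr_reg x : \sum_i chr i 1%g * chr i x = #|gT|%:R * (x == 1%g)%:R.
Proof.
have := congr1 (fun h : 'CF(G) => h x) (cfReg_sum G).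
rewrite sum_cfunE; under eq_bigr => j _ do rewrite cfunE.
by rewrite cfRegE cardsT mulr_natr => <-.
Qed.

Lemma cmodeZ a f i : cmode (fun g => a * f g) i = a * cmode f i.
Proof.
by rewrite /cmode mulrA mulr_sumr; congr (_ / _); apply: eq_bigr => g _; rewrite mulrA.
Qed.

Lemma eq_cmode f1 f2 i : f1 =1 f2 -> cmode f1 i = cmode f2 i.
Proof. by move=> f12; congr (_ / _); apply: eq_bigr => g _; rewrite f12. Qed.

(** Fourier inversion: summing the eigenvector relations against the dimensions produces the regular
    character, which is supported at 1. *)
Lemma cmode_inv f x : is_class f ->
  \sum_i chr i 1%g * cmode f i * chr i x = #|gT|%:R * f x^-1%g.
Proof.
move=> f_class; under eq_bigr => i _ do rewrite -mulrA -chr_eigen // mulr_sumr.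
rewrite exchange_big /= (bigD1 x^-1%g) //= [X in _ + X]big1 => [|g gx].
  under eq_bigr => i _ do rewrite mulVg mulrCA.
  by rewrite -mulr_sumr chr_reg eqxx mulr1 mulrC addr0.
under eq_bigr => i _ do rewrite mulrCA.
by rewrite -mulr_sumr chr_reg -eq_invg_mul -(inj_eq invg_inj) invgK (negPf gx) !mulr0.
Qed.

Lemma cmode_inj f1 f2 : is_class f1 -> is_class f2 ->
  (forall i, cmode f1 i = cmode f2 i) -> f1 =1 f2.
Proof.
move=> c1 c2 W x; have n0 : #|gT|%:R != 0 :> algC by rewrite -cardsT neq0CG.
apply: (mulfI n0); rewrite -[x]invgK -!cmode_inv //.
by apply: eq_bigr => i _; rewrite W.
Qed.

Lemma chr_conj i g : (chr i g)^* = chr i (g^-1)%g.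
Proof. by rewrite /chr char_inv ?irr_char. Qed.

Lemma cmode_conj f i : (forall g, f (g^-1)%g = (f g)^*) -> (cmode f i)^* = cmode f i.
Proof.
move=> fV; rewrite /cmode fmorph_div /= chr_conj invg1 rmorph_sum; congr (_ / _).
rewrite [RHS](reindex_inj invg_inj) /=.
by apply: eq_bigr => g _; rewrite rmorphM fV /= chr_conj.
Qed.

Lemma cmode_dual f i :
  cmode f (conjC_Iirr i) = cmode (fun g => f (g^-1)%g) i.
Proof.
have dual g : chr (conjC_Iirr i) g = chr i (g^-1)%g.
  by rewrite -chr_conj /chr conjC_IirrE cfunE.
rewrite /cmode dual invg1; congr (_ / _).
rewrite [RHS](reindex_inj invg_inj) /=.
by apply: eq_bigr => g _; rewrite dual invgK.
Qed.

Lemma cmodeD f1 f2 i : cmode (fun g => f1 g + f2 g) i = cmode f1 i + cmode f2 i.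
Proof.
rewrite /cmode -mulrDl -big_split; congr (_ / _).
by apply: eq_bigr => g _; rewrite mulrDl.
Qed.

(** Restricted to the cyclic group of x, the character is a sum of linear characters with natural
    multiplicities, and their values are n-th roots of unity. *)
Lemma chr_aut u k i x : acts_as_power n u k -> u (chr i x) = chr i (x ^+ k)%g.
Proof.
move=> uk; have sX : <[x]>%G \subset G by apply: finset.subsetT.
have xX : x \in <[x]>%g := cycle_id x.
rewrite /chr -(cfResE 'chi_i sX xX) -(cfResE 'chi_i sX (mem_cycle x k)).
rewrite (cfun_sum_constt ('Res[<[x]>%G] 'chi_i)) !sum_cfunE rmorph_sum /=.
apply: eq_bigr => j _; rewrite !cfunE rmorphM /=.
have /natrP[m ->] : '['Res[<[x]>%G] 'chi_i, 'chi_j] \in Num.nat.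
  by rewrite Cnat_cfdot_char ?cfRes_char ?irr_char.
have lin_j : 'chi_j \is a linear_char by rewrite irr_cyclic_lin ?cycle_cyclic.
rewrite rmorph_nat lin_charX // uk //.
by rewrite -lin_charX // expgG lin_char1.
Qed.

Lemma cmode_aut u k k' f i : acts_as_power n u k -> (k * k' = 1 %[mod n])%N ->
  u (cmode f i) = cmode (fun g => u (f (g ^+ k')%g)) i.
Proof.
move=> uk kk'; rewrite /cmode fmorph_div (chr_aut _ _ uk) expg1n; congr (_ / _).
have kK g := expg_inverseK g kk'.
rewrite rmorph_sum /= [RHS](reindex_inj (h := fun g => (g ^+ k)%g)) /=.
  by apply: eq_bigr => g _; rewrite rmorphM /= (chr_aut _ _ uk) -expgM kK.
by apply: (can_inj (g := fun g => (g ^+ k')%g)) => g; rewrite -expgM kK.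
Qed.

Lemma unit_inverse k : coprime k n -> exists k', (k * k' = 1 %[mod n])%N.
Proof.
move=> kn; have [k0|k0] := posnP k.
  by exists 0%N; move: kn; rewrite k0 /coprime gcd0n => /eqP ->; rewrite !modn1.
have [a b E _] := egcdnP n k0; exists a.
by rewrite mulnC E (eqP kn) modnMDl.
Qed.

(** An automorphism turns the modes of c into those of g |-> c (g ^ k'), with k' inverse to k modulo
    n, and multiplies s by a sign. Modes determine the weight, so rational ratios force the symmetry
    of c; conversely the symmetry makes the ratios Galois invariant. *)
Lemma cmode_Qsqrt c (s : algC) (Delta : int) : is_class c -> s ^+ 2 = Delta%:~R -> s != 0 ->
  (forall i, cmode (fun g => (c g)%:~R) i / s \in Crat) <->
  (forall u k (b : bool), (k < n)%N -> coprime k n -> acts_as_power n u k -> u s = (-1) ^+ b * s ->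
     forall g, c (g ^+ k)%g = (-1) ^+ b * c g).
Proof.
move=> cc ss s0; split=> [Ws u k b _ kn uk us|Hc i].
  have [k' kk'] := unit_inverse kn.
  pose f1 g : algC := (c (g ^+ k')%g)%:~R; pose f2 g : algC := (-1) ^+ b * (c g)%:~R.
  have f12 : f1 =1 f2.
    apply: cmode_inj => [x y|x y|i].
    - by rewrite /f1 -conjXg cc.
    - by rewrite /f2 cc.
    transitivity (u (cmode (fun g => (c g)%:~R) i)).
      by rewrite (cmode_aut _ _ uk kk'); apply: eq_cmode => g; rewrite rmorph_int.
    have /CratP[q /(canRL (divfK s0)) qs] := Ws i.
    by rewrite cmodeZ qs rmorphM fmorph_rat us mulrCA.
  move=> g; have := f12 (g ^+ k)%g.
  rewrite /f1 /f2 -expgM (expg_inverseK _ kk').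
  rewrite -(rmorph_sign _ b : ((-1) ^+ b)%:~R = _) -rmorphM /= => /eqP; rewrite eqr_int => /eqP ->.
  by rewrite mulrA -expr2 sqrr_sign mul1r.
apply: algC_fixed_rat => u; have [k [ltkn kn uk]] := aut_acts_as_power u expG_gt0.
have [k' kk'] := unit_inverse kn.
have [b us] : exists b : bool, u s = (-1) ^+ b * s.
  have : u s ^+ 2 == s ^+ 2 by rewrite -rmorphXn /= ss rmorph_int.
  rewrite eqf_sqr => /orP[]/eqP ->; [exists false|exists true]; by rewrite ?mul1r ?mulN1r.
rewrite fmorph_div us (cmode_aut _ _ uk kk').
have -> : cmode (fun g => u (c (g ^+ k')%g)%:~R) i = (-1) ^+ b * cmode (fun g => (c g)%:~R) i.
  rewrite -cmodeZ; apply: eq_cmode => g; rewrite rmorph_int.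
  have := Hc u k b ltkn kn uk us (g ^+ k')%g; rewrite -expgM mulnC (expg_inverseK _ kk').
  by move=> ->; rewrite rmorphM /= rmorph_sign mulrA -expr2 sqrr_sign mul1r.
by rewrite -mulf_div divff ?signr_eq0 // mul1r.
Qed.
End ClassFunctions.

(** * The square-free integer D *)

Lemma nat_squarefree_part m : (0 < m)%N ->
  exists D e, [/\ (0 < D)%N, squarefree D, (0 < e)%N & (m = D * (e * e))%N].
Proof.
(* The square part is the largest e whose square divides m. *)
move=> m0; pose P e := (e * e %| m)%N.
have exP : exists e, P e by exists 1%N; rewrite /P dvd1n.
have ubP e : P e -> (e <= m)%N.
  move=> /(dvdn_leq m0); apply: leq_trans; case: e => // e; exact: leq_pmulr.
have [e Pe emax] := ex_maxnP exP ubP.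
have e0 : (0 < e)%N by apply: emax; rewrite /P dvd1n.
exists (m %/ (e * e))%N, e; split=> //; last by rewrite divnK.
  by rewrite divn_gt0 ?muln_gt0 ?e0 // dvdn_leq.
move=> d d1; apply/negP => dd.
have : P (d * e)%N.
  by rewrite /P mulnACA -(divnK Pe) dvdn_pmul2r // muln_gt0 e0.
by move/emax; rewrite leqNgt -{1}[e]mul1n ltn_pmul2r ?d1.
Qed.

Lemma rat_squarefree_part (r : rat) : 0 < r ->
  exists D (q : rat), [/\ (0 < D)%N, squarefree D, q != 0 & r = D%:R * q ^+ 2].
Proof.
move=> r0; have [nr0 dr0] : (0 < `|numq r|)%N /\ (0 < `|denq r|)%N.
  by rewrite !absz_gt0 numq_eq0 denq_neq0 gt_eqF.
(* Since a / b = a b / b^2, D is the square-free part of the product a b. *)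
have [|D [e [D0 sqf e0 E]]] := @nat_squarefree_part (`|numq r| * `|denq r|)%N; first by rewrite muln_gt0 nr0.
exists D, (e%:R / `|denq r|%:R); split=> //.
  by rewrite mulf_neq0 ?invr_eq0 // pnatr_eq0 -lt0n.
have d0 : `|denq r|%:R != 0 :> rat by rewrite pnatr_eq0 -lt0n.
have rE : r = `|numq r|%:R / `|denq r|%:R.
  by rewrite -{1}[r]divq_num_den !pmulrn !gez0_abs // ltW // numq_gt0.
have H : `|numq r|%:R * `|denq r|%:R = D%:R * (e%:R * e%:R) :> rat by rewrite -!natrM E.
transitivity (`|numq r|%:R * `|denq r|%:R / `|denq r|%:R ^+ 2 : rat); last by rewrite H; field.
by rewrite {1}rE; field.
Qed.

(** Otherwise s is rational and an algebraic integer, hence an integer, and D is a perfect square,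
    which a square-free D other than 1 is not. *)
Lemma squarefree_sqrt_irrational D : (0 < D)%N -> squarefree D -> D != 1%N ->
  forall s : algC, s ^+ 2 = D%:R -> exists u : {rmorphism algC -> algC}, u s = - s.
Proof.
move=> D0 sqf D1 s ss.
have [[u us]|nu] := pselect (exists u : {rmorphism algC -> algC}, u s = - s); first by exists u.
have /algC_fixed_rat sQ : forall u : {rmorphism algC -> algC}, u s = s.
  move=> u; have : u s ^+ 2 == s ^+ 2 by rewrite -rmorphXn /= ss rmorph_nat.
  by rewrite eqf_sqr => /orP[/eqP //|/eqP us]; case: nu; exists u.
have sA : s \in Aint.
  have : root ('X^2 - D%:R%:P) s by rewrite rootE !hornerE ss subrr.
  move/root_monic_Aint; apply; first exact: monicXnsubC.
  apply/polyOverP => i; rewrite coefB coefC coefXn rpredB ?rpred_nat //.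
  by case: (i == 0%N); rewrite ?rpred_nat ?rpred0.
have /intrP[m sm] := Cint_rat_Aint sQ sA.
have : (D = `|m| * `|m|)%N.
  apply/eqP; rewrite -(eqr_nat algC) -ss sm -abszM -[_%:R]/((`|_|%N : int)%:~R) gez0_abs.
    by rewrite expr2 rmorphM.
  by rewrite -expr2 sqr_ge0.
move=> DE; have := sqf `|m|%N; rewrite {1}DE dvdnn => h.
have : (`|m| <= 1)%N by rewrite leqNgt; apply/negP => /h.
by case: (absz m) DE D0 D1 => [|[|]] // ->.
Qed.

Lemma unity_conj m (z : algC) : (0 < m)%N -> z ^+ m = 1 -> z^* = z ^+ m.-1.
Proof.
move=> m0 zm; have z1 : `|z| == 1 by rewrite -(pexpr_eq1 m0) // -normrX zm normr1.
have z0 : z != 0 by rewrite -normr_eq0 (eqP z1) oner_eq0.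
by apply: (mulfI z0); rewrite -normCK (eqP z1) expr1n -exprS prednK ?zm.
Qed.

Lemma acts_as_power_inj m u k l : (0 < m)%N ->
  acts_as_power m u k -> acts_as_power m u l -> (k = l %[mod m])%N.
Proof.
move=> m0 uk ul; have [z zp] := C_prim_root_exists m0.
apply/eqP; rewrite -(eq_prim_root_expr zp).
by rewrite -(uk _ (prim_expr_order zp)) (ul _ (prim_expr_order zp)).
Qed.

(** * The odd and even parts of the walk and their modes *)

Section Modes.
Variables (gT : finGroupType) (Ci C1 Cm1 : {set gT}).
Local Notation n := (expG gT).
Hypotheses (cCi : conj_closed Ci) (cC1 : conj_closed C1) (cCm1 : conj_closed Cm1).
Hypotheses (dCi : [disjoint Ci & setinv Ci]) (dC1 : [disjoint C1 & Cm1]).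
Hypotheses (sC1 : setinv C1 = C1) (sCm1 : setinv Cm1 = Cm1).

Lemma mem_setinv (C : {set gT}) x : (x \in setinv C) = ((x^-1)%g \in C).
Proof.
apply/imsetP/idP => [[y yC ->]|xC]; first by rewrite invgK.
by exists (x^-1)%g; rewrite ?invgK.
Qed.

Lemma conj_closedE (C : {set gT}) : conj_closed C -> forall x y, ((x ^ y)%g \in C) = (x \in C).
Proof.
by move=> cC x y; apply/idP/idP => [/(cC _ (y^-1)%g)|/cC//]; rewrite -conjgM mulgV conjg1.
Qed.

(** The weight of an arc is i times this plus [even_part]. By disjointness the connection sets are
    level sets of these functions, so symmetries of the functions are symmetries of the sets. *)
Definition odd_part (x : gT) : int := (x \in Ci)%:R - (x \in setinv Ci)%:R.
Definition even_part (x : gT) : int := (x \in C1)%:R - (x \in Cm1)%:R.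

Lemma odd_part_class : is_class odd_part.
Proof. by move=> x y; rewrite /odd_part !mem_setinv -conjVg !conj_closedE. Qed.

Lemma even_part_class : is_class even_part.
Proof. by move=> x y; rewrite /even_part !conj_closedE. Qed.

Lemma odd_partV x : odd_part (x^-1)%g = - odd_part x.
Proof. by rewrite /odd_part !mem_setinv invgK opprB. Qed.

Lemma even_partV x : even_part (x^-1)%g = even_part x.
Proof. by rewrite /even_part -{1}sC1 -{1}sCm1 !mem_setinv invgK. Qed.

Lemma odd_part1 x : (odd_part x == 1) = (x \in Ci).
Proof.
rewrite /odd_part; have [xC|_] := boolP (x \in Ci); last by case: (x \in setinv Ci).
by rewrite (disjointFr dCi xC).
Qed.

Lemma even_part1 x : (even_part x == 1) = (x \in C1).
Proof.
rewrite /even_part; have [xC|_] := boolP (x \in C1); last by case: (x \in Cm1).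
by rewrite (disjointFr dC1 xC).
Qed.

Lemma even_partN1 x : (even_part x == -1) = (x \in Cm1).
Proof.
rewrite /even_part; have [xC|_] := boolP (x \in Cm1); last by case: (x \in C1).
by rewrite (disjointFl dC1 xC).
Qed.

Lemma union_of_sim_pow Delta (C : {set gT}) k x : union_of_sim Delta C -> inH n Delta k ->
  ((x ^+ k)%g \in C) = (x \in C).
Proof. by move=> U Hk; apply: U; exists k; split=> //; exists 1%g; rewrite conjg1. Qed.

Variable D : nat.
Hypotheses (D0 : (0 < D)%N) (sqf : squarefree D).
Let s : algC := sqrtC D%:R.

Lemma odd_modes_rational :
  (forall i, cmode (fun g => (odd_part g)%:~R) i / ('i * s) \in Crat) <->
  (admissible n (- (D : int)) -> union_of_sim (- (D : int)) Ci) /\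
  (~ admissible n (- (D : int)) -> Ci = finset.set0).
Proof.
set t := 'i * s.
have tt : t ^+ 2 = (- (D : int))%:~R.
  by rewrite exprMn sqrCi sqrtCK mulN1r rmorphN.
have Dn0 : - (D : int) != 0 by rewrite oppr_eq0 -lt0n.
have t0 : t != 0 by rewrite mulf_neq0 ?neq0Ci // sqrtC_eq0 pnatr_eq0 -lt0n.
have n0 := expG_gt0 gT.
rewrite (cmode_Qsqrt odd_part_class tt t0); split=> [H|[Hadm Hnadm] u k b kn ck uk ut g].
  split=> [adm g h [k [Hk [x ->]]]|nadm].
    have [kn ck _] := Hk; have [u uk] := Qn_aut_exists ck.
    have ut := (inH_fixes n0 adm Dn0 tt kn ck uk).1 Hk.
    rewrite -!odd_part1 odd_part_class (H u k false) ?expr0 ?mul1r //.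
  (* An automorphism trivial on the n-th roots of unity and negating [t] forces the odd part to
     equal its own negative. *)
  have [|u [u1 ut]] := nonadmissible_aut n0 D0 sqf _ nadm tt; first by rewrite abszN.
  apply/finset.setP => x; rewrite finset.in_set0 -odd_part1; apply/negP => /eqP ox.
  have [k [kn ck uk]] := aut_acts_as_power u n0.
  have := H u k true kn ck uk; rewrite mulN1r => /(_ ut x).
  rewrite -(expg_mod k (expgG x)) (acts_as_power_inj n0 uk u1) (expg_mod 1 (expgG x)) expg1.
  by rewrite ox.
have [adm|nadm] := pselect (admissible n (- (D : int))); last first.
  by rewrite /odd_part !mem_setinv (Hnadm nadm) !inE subrr mulr0.
have inv k' : inH n (- (D : int)) k' -> odd_part (g ^+ k')%g = odd_part g.
  move=> Hk; rewrite /odd_part !mem_setinv -expgVn.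
  by rewrite !(union_of_sim_pow _ (Hadm adm) Hk).
case: b ut => ut; last by rewrite mul1r inv //; apply/(inH_fixes n0 adm Dn0 tt kn ck uk); rewrite ut mul1r.
(* Here [u] negates [t]. As [t] is purely imaginary, composing with conjugation gives an
   automorphism fixing it; on roots of unity conjugation is the power n - 1, so [k'] is in H.
   Inversion then supplies the minus sign of the odd part. *)
pose v : {rmorphism algC -> algC} := u \o Num.conj.
pose k' := (k * n.-1 %% n)%N.
have vk : acts_as_power n v k'.
  move=> z z1; rewrite /= (unity_conj n0 z1) rmorphXn /= uk //.
  by rewrite /k' expr_mod // exprM.
have Hk : inH n (- (D : int)) k'.
  apply/(inH_fixes n0 adm Dn0 tt _ _ vk); first by rewrite ltn_pmod.
    by rewrite coprime_modl coprimeMl ck coprimePn.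
  have s_real : s^* = s by apply: conj_Creal; rewrite ger0_real // sqrtC_ge0 ler0n.
  have tJ : t^* = - t by rewrite /t rmorphM /= conjCi s_real mulNr.
  by rewrite /= tJ rmorphN ut mulN1r opprK.
have := inv k' Hk; rewrite /k' expg_mod ?expgG // expgM.
have -> : ((g ^+ k) ^+ n.-1 = (g ^+ k)^-1)%g.
  by apply/eqP; rewrite eq_sym eq_invg_mul -expgS prednK // expgG.
by rewrite odd_partV mulN1r => <-; rewrite opprK.
Qed.

Lemma even_modes_rational :
  (forall i, cmode (fun g => (even_part g)%:~R) i / s \in Crat) <->
  (admissible n (D : int) ->
       [/\ union_of_sim (D : int) C1, union_of_sim (D : int) Cm1 &
           ((D != 1)%N -> exists k : nat,
              [/\ (k < n)%N, coprime k n,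
                  ~ inH n (D : int) k & C1 = setpow Cm1 k])]) /\
  (~ admissible n (D : int) -> C1 = finset.set0 /\ Cm1 = finset.set0).
Proof.
have ss : s ^+ 2 = (D : int)%:~R by rewrite sqrtCK.
have Dn0 : (D : int) != 0 by rewrite -lt0n.
have s0 : s != 0 by rewrite sqrtC_eq0 pnatr_eq0 -lt0n.
have n0 := expG_gt0 gT.
rewrite (cmode_Qsqrt even_part_class ss s0); split=> [H|[Hadm Hnadm] u k b kn ck uk us g].
  split=> [adm|nadm].
    have inv k x : inH n (D : int) k -> even_part (x ^+ k)%g = even_part x.
      move=> Hk; have [kn ck _] := Hk; have [u uk] := Qn_aut_exists ck.
      have us := (inH_fixes n0 adm Dn0 ss kn ck uk).1 Hk.
      by rewrite (H u k false) ?expr0 ?mul1r.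
    split=> [g h [k [Hk [x ->]]]|g h [k [Hk [x ->]]]|D1].
    - by rewrite -!even_part1 even_part_class inv.
    - by rewrite -!even_partN1 even_part_class inv.
    (* The exponent of an automorphism negating sqrt(D) exchanges the level sets 1 and -1 of the
       even part. *)
    have [u us] := squarefree_sqrt_irrational D0 sqf D1 ss.
    have [k [kn ck uk]] := aut_acts_as_power u n0.
    have ek x : even_part (x ^+ k)%g = - even_part x.
      by rewrite (H u k true) ?mulN1r.
    exists k; split=> //.
      move/(inH_fixes n0 adm Dn0 ss kn ck uk); rewrite us => /eqP.
      by rewrite eq_sym -subr_eq0 opprK -mulr2n mulrn_eq0 (negPf s0).
    have [k' kk'] := unit_inverse ck.
    apply/finset.setP => x; apply/idP/imsetP => [xC|[y yC ->]].
      exists (x ^+ k')%g; last by rewrite -expgM mulnC expg_inverseK.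
      by rewrite -even_partN1 -eqr_oppLR -ek -expgM mulnC expg_inverseK // even_part1.
    by rewrite -even_part1 ek eqr_oppLR even_partN1.
  have [|u [u1 us]] := nonadmissible_aut n0 D0 sqf _ nadm ss; first by [].
  have e0 x : even_part x = 0.
    have [k [kn ck uk]] := aut_acts_as_power u n0.
    have := H u k true kn ck uk; rewrite mulN1r => /(_ us x).
    rewrite -(expg_mod k (expgG x)) (acts_as_power_inj n0 uk u1) (expg_mod 1 (expgG x)) expg1.
    by rewrite mulN1r => /eqP; rewrite -subr_eq0 opprK -mulr2n mulrn_eq0 => /eqP.
  by split; apply/finset.setP => x; rewrite finset.in_set0 -?even_part1 -?even_partN1 e0.
have [adm|nadm] := pselect (admissible n (D : int)); last first.
  by rewrite /even_part; have [-> ->] := Hnadm nadm; rewrite !finset.inE subrr mulr0.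
have [U1 Um1 Hk] := Hadm adm.
(* H contains only representatives below n, so products of exponents must first be reduced modulo
   n. *)
have inv (C : {set gT}) k' x : union_of_sim (D : int) C -> coprime k' n ->
    (forall v, acts_as_power n v k' -> v s = s) ->
    ((x ^+ k')%g \in C) = (x \in C).
  move=> U ck' vs; have ck'' : coprime (k' %% n) n by rewrite coprime_modl.
  have [v vk] := Qn_aut_exists ck''; rewrite -(expg_mod k' (expgG x)).
  have Hk' : inH n (D : int) (k' %% n)%N.
    apply/(inH_fixes n0 adm Dn0 ss _ ck'' vk); first by rewrite ltn_pmod.
    by apply: vs => z z1; rewrite vk // expr_mod.
  exact: (union_of_sim_pow x U Hk').
case: b us => us; last first.
  rewrite mul1r /even_part.
  have vs v : acts_as_power n v k -> v s = s.
    move=> vk; apply/(inH_fixes n0 adm Dn0 ss kn ck vk).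
    by apply/(inH_fixes n0 adm Dn0 ss kn ck uk); rewrite us mul1r.
  by rewrite !inv.
have D1 : D != 1%N.
  apply/eqP => D1; move: us; rewrite /s D1 sqrtC1 rmorph1 expr1 mulr1 => /eqP.
  by rewrite -subr_eq0 opprK -mulr2n mulrn_eq0 oner_eq0.
have [k0 [kn0 ck0 nHk0 C1E]] := Hk D1.
have [w wk0] := Qn_aut_exists ck0.
have ws : w s = - s.
  have : w s ^+ 2 == s ^+ 2 by rewrite -rmorphXn /= ss rmorph_int.
  rewrite eqf_sqr => /orP[|]/eqP // ws; case: nHk0.
  by apply/(inH_fixes n0 adm Dn0 ss kn0 ck0 wk0).
rewrite expr1 mulN1r in us.
(* The product of two exponents that negate s fixes s. Hence k k0 preserves both sets, and k acts on
   them like the given k0. *)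
have compose (v1 v2 : {rmorphism algC -> algC}) l1 l2 : coprime l1 n -> coprime l2 n ->
    acts_as_power n v1 l1 -> acts_as_power n v2 l2 -> v1 s = - s -> v2 s = - s ->
    forall v, acts_as_power n v (l1 * l2) -> v s = s.
  move=> c1 c2 a1 a2 s1 s2 v va; pose l := (l1 * l2 %% n)%N.
  have ln : (l < n)%N by rewrite ltn_pmod.
  have cl : coprime l n by rewrite coprime_modl coprimeMl c1.
  have vl : acts_as_power n v l by move=> z z1; rewrite va // expr_mod.
  have v12l : acts_as_power n (v1 \o v2) l.
    by move=> z z1; rewrite /= a2 // rmorphXn /= a1 // -exprM /l expr_mod.
  apply/(inH_fixes n0 adm Dn0 ss ln cl vl); apply/(inH_fixes n0 adm Dn0 ss ln cl v12l).
  by rewrite /= s2 rmorphN s1 opprK.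
(* [C1E] only describes an image; it becomes an equivalence because k0 k0 preserves [Cm1]. *)
have k0C1 x : ((x ^+ k0)%g \in C1) = (x \in Cm1).
  apply/idP/idP => [|xC]; last by rewrite C1E; apply/imsetP; exists x.
  rewrite C1E => /imsetP[y yC xy].
  rewrite -(inv Cm1 (k0 * k0)%N x) // ?coprimeMl ?ck0 //; last exact: (compose _ _ _ _ _ _ wk0 wk0 ws ws).
  rewrite expgM xy -expgM inv // ?coprimeMl ?ck0 //; exact: (compose _ _ _ _ _ _ wk0 wk0 ws ws).
have k0Cm1 x : ((x ^+ k0)%g \in Cm1) = (x \in C1).
  rewrite -k0C1 -expgM inv // ?coprimeMl ?ck0 //; exact: (compose _ _ _ _ _ _ wk0 wk0 ws ws).
have ckk0 : coprime (k * k0) n by rewrite coprimeMl ck.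
rewrite /even_part -k0Cm1 -expgM inv //; last exact: (compose _ _ _ _ _ _ uk wk0 us ws).
rewrite -(k0C1 (g ^+ k)%g) -expgM inv //; last exact: (compose _ _ _ _ _ _ uk wk0 us ws).
by rewrite expr1 mulN1r opprB.
Qed.

Definition walk_weight (g : gT) : algC := 'i * (odd_part g)%:~R + (even_part g)%:~R.

Lemma walk_weight_class : is_class walk_weight.
Proof. by move=> x y; rewrite /walk_weight odd_part_class even_part_class. Qed.

Lemma walk_weightV g : walk_weight (g^-1)%g = (walk_weight g)^*.
Proof.
rewrite /walk_weight odd_partV even_partV; move: (odd_part g) (even_part g) => x y.
by rewrite rmorphD rmorphM /= conjCi !rmorph_int rmorphN mulrN mulNr.
Qed.

(** Passing to the dual character negates the contribution of the odd part and keeps that of the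
    even part, so half differences and half sums of modes isolate them. *)
Lemma walk_modes_split :
  (forall i, cmode walk_weight i / s \in Crat) <->
  (forall i, cmode (fun g => (odd_part g)%:~R) i / ('i * s) \in Crat) /\
  (forall i, cmode (fun g => (even_part g)%:~R) i / s \in Crat).
Proof.
set A := cmode (fun g => (odd_part g)%:~R); set B := cmode (fun g => (even_part g)%:~R).
have WE i : cmode walk_weight i = 'i * A i + B i by rewrite /walk_weight cmodeD cmodeZ.
have WJ i : cmode walk_weight (conjC_Iirr i) = - ('i * A i) + B i.
  rewrite cmode_dual -mulrN -[- A i]mulN1r -!cmodeZ -cmodeD; apply: eq_cmode => g.
  by rewrite /walk_weight odd_partV even_partV rmorphN mulN1r.
have s0 : s != 0 by rewrite sqrtC_eq0 pnatr_eq0 -lt0n.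
have i0 : 'i != 0 :> algC := neq0Ci _.
have ii : 'i * 'i = -1 :> algC by rewrite -expr2 sqrCi.
have Ai i : A i / ('i * s) = - ('i * A i / s).
  apply: (canLR (mulfK _)); first by rewrite mulf_neq0.
  transitivity (- ('i * 'i) * A i * (s / s)); last by ring.
  by rewrite ii opprK mul1r divff // mulr1.
split=> [H|[HA HB] i]; last first.
  by rewrite WE mulrDl rpredD // -[_ / s]opprK rpredN -Ai.
split=> i.
  rewrite Ai (_ : - _ = (cmode walk_weight (conjC_Iirr i) / s - cmode walk_weight i / s) / 2%:R).
    by rewrite rpredM ?rpredB ?rpredV ?rpred_nat.
  by rewrite WJ WE; field.
rewrite (_ : _ / _ = (cmode walk_weight (conjC_Iirr i) / s + cmode walk_weight i / s) / 2%:R).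
  by rewrite rpredM ?rpredD ?rpredV ?rpred_nat.
by rewrite WJ WE; field.
Qed.
End Modes.

(** * Real numbers with rational pairwise products *)

Section CommonSquareRoot.
Variables (I : finType) (W : I -> algC).
Hypothesis W_real : forall i, (W i)^* = W i.

(** A nonzero W i0 has a positive rational square D q^2 with D square-free, and every W i is a
    rational multiple of W i0 = +- q sqrt(D). If all W i vanish, D = 1 serves. *)
Lemma common_sqrt :
  (forall i j, W i * W j \in Crat) <->
  exists D, [/\ (0 < D)%N, squarefree D & forall i, W i / sqrtC D%:R \in Crat].
Proof.
split=> [H|[D [D0 sqf H]] i j]; last first.
  have s0 : sqrtC D%:R != 0 :> algC by rewrite sqrtC_eq0 pnatr_eq0 -lt0n.
  rewrite -(divfK s0 (W i)) -(divfK s0 (W j)) mulrACA -expr2 sqrtCK.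
  apply: rpredM; [apply: rpredM; exact: H|exact: rpred_nat].
have [/existsP[i0 Wi0]|] := boolP [exists i, W i != 0]; last first.
  rewrite negb_exists => /forallP W0; exists 1%N; split=> // [d d1|i].
    by rewrite dvdn1 muln_eq1 andbb neq_ltn d1 orbT.
  by have := W0 i; rewrite negbK => /eqP ->; rewrite mul0r rpred0.
have /CratP[r rE] := H i0 i0.
have r0 : 0 < r.
  rewrite -(ltr0q algC) -rE; have := mul_conjC_gt0 (W i0); rewrite W_real => ->; exact: Wi0.
have [D [q [D0 sqf q0 rq]]] := rat_squarefree_part r0.
have Q0 : ratr q != 0 :> algC by rewrite fmorph_eq0.
exists D; split=> // i.
have s0 : sqrtC D%:R != 0 :> algC by rewrite sqrtC_eq0 pnatr_eq0 -lt0n.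
have : (W i0 / ratr q) ^+ 2 == sqrtC D%:R ^+ 2.
  rewrite sqrtCK expr_div_n expr2 rE rq rmorphM rmorph_nat rmorphXn /= mulfK //.
  by rewrite expf_neq0.
have key : W i / (W i0 / ratr q) \in Crat.
  have -> : W i / (W i0 / ratr q) = W i * W i0 * (ratr q / (W i0 * W i0)) by field; rewrite Wi0.
  by rewrite rE rpredM ?H // rpredM ?rpredV ?Crat_rat.
rewrite eqf_sqr => /orP[]/eqP E; first by rewrite -E.
by rewrite -[sqrtC _]opprK -E invrN mulrN rpredN.
Qed.
End CommonSquareRoot.

(** * Embedding number fields *)

(** The map p(w) |-> p(z), for z a root in F of the minimal polynomial of w, is well defined because
    that polynomial divides every p vanishing at w. *)
Lemma num_field_embedding (K : fieldExtType rat) (w : K) (F : numClosedFieldType) :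
  <<1; w>>%VS = fullv -> exists phi : {rmorphism K -> F}, True.
Proof.
move=> genw.
pose ev (q : {poly rat}) := (map_poly (in_alg K) q).[w].
have [P PE] := polyOver1P (minPolyOver 1 w).
have ev0 q : ev q = 0 -> P %| q.
  move=> /eqP evq; rewrite -(dvdp_map (in_alg K)) -PE minPoly_dvdp //.
  by apply/polyOver1P; exists q.
have ev_surj x : exists q, ev q == x.
  have xw : x \in <<1; w>>%VS by rewrite genw memvf.
  have [q qE] := polyOver1P (Fadjoin_polyOver 1 w x).
  by exists q; rewrite /ev -qE Fadjoin_poly_eq.
have [z Pz] : exists z : F, root (map_poly ratr P) z.
  apply/closed_rootP; rewrite size_map_poly -(size_map_poly (in_alg K)) -PE.
  by rewrite size_minPoly.
pose q x := xchoose (ev_surj x).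
have qE x : ev (q x) = x by apply/eqP; exact: (xchooseP (ev_surj x)).
pose phi x : F := (map_poly ratr (q x)).[z].
have phiE p : phi (ev p) = (map_poly ratr p).[z].
  apply/eqP; rewrite /phi -subr_eq0 -hornerN -hornerD -rmorphN -rmorphD /=.
  have : P %| q (ev p) - p.
    by apply: ev0; rewrite /ev rmorphB /= hornerD hornerN -!/(ev _) qE subrr.
  rewrite -(dvdp_map (ratr : rat -> F)) => dv.
  have := dvdp_trans _ dv; move=> /(_ ('X - z%:P)).
  by rewrite !dvdp_XsubCl rmorphB /=; apply; exact: Pz.
have phiB : zmod_morphism phi.
  move=> x y; rewrite -{1}[x]qE -{1}[y]qE.
  have -> : ev (q x) - ev (q y) = ev (q x - q y) by rewrite /ev rmorphB hornerD hornerN.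
  by rewrite phiE rmorphB hornerD hornerN.
have phiM : monoid_morphism phi.
  split; first by rewrite -[1](_ : ev 1 = _) ?phiE /ev rmorph1 hornerC.
  move=> x y; rewrite -{1}[x]qE -{1}[y]qE.
  have -> : ev (q x) * ev (q y) = ev (q x * q y) by rewrite /ev rmorphM hornerM.
  by rewrite phiE rmorphM hornerM.
pose phiA := GRing.isZmodMorphism.Build K F phi phiB.
pose phiMM := GRing.isMonoidMorphism.Build K F phi phiM.
by exists (HB.pack phi phiA phiMM : {rmorphism K -> F}).
Qed.

(** * The exponential series on eigenvectors *)

Section Convergence.
Local Open Scope classical_set_scope.

Lemma cvg_mx_entry (T : topologicalType) m n (F : nat -> 'M[T]_(m, n)) (M : 'M[T]_(m, n)) :
  (F @ \oo --> M) <-> (forall i j, (fun k => F k i j) @ \oo --> M i j).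
Proof.
split=> [FM i j A nA|H A [P PM PA]].
  apply: (FM [set N : 'M[T]_(m,n) | A (N i j)]).
  exists (fun i' j' => if (i' == i) && (j' == j) then A else setT).
    move=> i' j'; case: ifP => [/andP[/eqP -> /eqP ->] //|_]; exact: filterT.
  by move=> N /(_ i j); rewrite !eqxx.
suff : \forall k \near \oo, forall ij : 'I_m * 'I_n, P ij.1 ij.2 (F k ij.1 ij.2).
  by apply: filterS => k Hk; apply: PA => i j; exact: (Hk (i, j)).
apply: filter_forall => -[i j]; exact: H (PM i j).
Qed.

Section Complex.
Variable R : realType.

Lemma cvg_complexP (u : nat -> R[i]) (l : R[i]) :
  (u @ \oo --> l) <->
  ((fun k => complex.Re (u k)) @ \oo --> complex.Re l) /\
  ((fun k => complex.Im (u k)) @ \oo --> complex.Im l).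
Proof.
have ballE (x y e : R[i]) : ball x e y = (`|x - y| < e) :> Prop by [].
have ReB (x y : R[i]) : complex.Re (x - y) = complex.Re x - complex.Re y by case: x y => [? ?] [].
have ImB (x y : R[i]) : complex.Im (x - y) = complex.Im x - complex.Im y by case: x y => [? ?] [].
split=> [/cvg_ballP ul|[/cvgrPdist_lt Hre /cvgrPdist_lt Him]].
  split; apply/cvgrPdist_lt => e e0; have := ul e%:C%C; rewrite ltcR => /(_ e0);
    apply: filterS => k; rewrite ballE normc_def ltcR; apply: le_lt_trans.
    by rewrite -ReB -sqrtr_sqr ler_sqrt ?addr_ge0 ?sqr_ge0 // lerDl sqr_ge0.
  by rewrite -ImB -sqrtr_sqr ler_sqrt ?addr_ge0 ?sqr_ge0 // lerDr sqr_ge0.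
(* The radius is itself a complex number, and its positivity forces it to be real. *)
apply/cvg_ballP => e; rewrite ltcE /= => /andP[/eqP ei er].
have e2 : 0 < complex.Re e / 2 by rewrite divr_gt0.
near=> k; rewrite ballE.
have -> : e = (complex.Re e)%:C%C by rewrite {1}[e]complexE ei mulr0 addr0.
have := @ler_normD _ R[i] (complex.Re (l - u k))%:C%C ('i%C * (complex.Im (l - u k))%:C%C).
rewrite -complexE => /le_lt_trans; apply.
have iN : `|'i%C : R[i]| = 1 by rewrite normc_def /= expr0n expr1n add0r sqrtr1.
have rN (x : R) : `|x%:C%C| = (`|x|)%:C%C by rewrite normc_def /= expr0n addr0 sqrtr_sqr.
rewrite normrM iN mul1r !rN -rmorphD ltcR ReB ImB (splitr (complex.Re e)).
by apply: ltrD; near: k; [exact: Hre|exact: Him].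
Unshelve. all: by end_near. Qed.

Definition cis (x : R) : R[i] := Complex (cos x) (sin x).

Lemma exp_i_coeff (x : R) k :
  (iC R * x%:C%C) ^+ k / (k`!)%:R = Complex (cos_coeff x k) (sin_coeff x k) :> R[i].
Proof.
have iE : iC R ^+ k = Complex ((~~ odd k)%:R * (-1) ^+ k./2) ((odd k)%:R * (-1) ^+ k.-1./2).
  have i2 : iC R ^+ 2 = (-1 : R)%:C%C by rewrite sqr_i rmorphN1.
  rewrite -{1}(odd_double_half k) exprD -mul2n exprM i2 -rmorphXn.
  case: (boolP (odd k)) => ok /=.
    have -> : (k.-1)./2 = k./2 by rewrite -{1}(odd_double_half k) ok add1n /= doubleK.
    by rewrite expr1 /iC; simpc; rewrite ?mul0r ?mul1r.
  by rewrite expr0 mul1r; simpc; rewrite ?mul0r ?mul1r.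
have -> : (iC R * x%:C%C) ^+ k / (k`!)%:R = iC R ^+ k * (x ^+ k / (k`!)%:R)%:C%C.
  by rewrite exprMn -mulrA rmorphM fmorphV rmorphXn rmorph_nat.
rewrite iE /cos_coeff /sin_coeff /= -?exprnP; simpc.
by congr Complex; rewrite ?mulrA.
Qed.

Lemma cvg_cis (x : R) :
  series (fun k => (iC R * x%:C%C) ^+ k / (k`!)%:R : R[i]) @ \oo --> cis x.
Proof.
have sE n : series (fun k => (iC R * x%:C%C) ^+ k / (k`!)%:R : R[i]) n =
    Complex (series (cos_coeff x) n) (series (sin_coeff x) n).
  rewrite /series /=; elim: n => [|n IH]; first by rewrite !big_geq.
  by rewrite !big_nat_recr //= IH exp_i_coeff.
apply/cvg_complexP; split; rewrite /cis /=.
  rewrite (_ : (fun _ => _) = series (cos_coeff x)).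
    by rewrite cos.unlock; exact: is_cvg_series_cos_coeff.
  by apply/funext => n; rewrite sE.
rewrite (_ : (fun _ => _) = series (sin_coeff x)).
  by rewrite sin.unlock; exact: is_cvg_series_sin_coeff.
by apply/funext => n; rewrite sE.
Qed.

(** The remainder r of x - y modulo 2 pi has cos r = 1 - 2 sin(r/2)^2 = 1, whereas sin(r/2) > 0 for
    0 < r < 2 pi. *)
Lemma cis_eq (x y : R) : cis x = cis y -> exists m : int, x - y = m%:~R * (pi *+ 2).
Proof.
move=> [cxy sxy].
have c1 : cos (x - y) = 1 by rewrite cosB cxy sxy -!expr2 cos2Dsin2.
have p2 : 0 < pi *+ 2 :> R by rewrite pmulrn_lgt0 ?pi_gt0.
pose m := Num.floor ((x - y) / (pi *+ 2)); exists m.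
pose r := x - y - m%:~R * (pi *+ 2).
have cosDz (k : int) (z : R) : cos (z + k%:~R * (pi *+ 2)) = cos z.
  case: k => k; first by rewrite -pmulrn mulr_natl (periodicn (@cosD2pi R)).
  rewrite NegzE mulrNz mulNr -[in RHS](subrK (k.+1%:~R * (pi *+ 2)) z).
  by rewrite -pmulrn mulr_natl (periodicn (@cosD2pi R)).
have cr : cos r = 1 by rewrite /r -mulNr -mulrNz cosDz.
have /andP[r0 r2] : 0 <= r < pi *+ 2.
  rewrite /r subr_ge0 ltrBlDl -ler_pdivlMr // ge_floor.
  by have := lt_succ_floor ((x - y) / (pi *+ 2)); rewrite -/m intrD ltr_pdivrMr // mulrDl mul1r.
apply/eqP; rewrite -subr_eq0 -/r eq_le r0 andbT leNgt; apply/negP => r_gt0.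
have : 0 < sin (r / 2).
  by apply: sin_gt0_pi; rewrite divr_gt0 //= ltr_pdivrMr // mulr_natr.
have : cos (r / 2 *+ 2) = 1 by rewrite -mulr_natr divfK.
rewrite cos_mulr2n cos2sin2 => E s0.
have : sin (r / 2) ^+ 2 = 0.
  move: E; set q := _ ^+ 2 => E; have : q *+ 2 = 0 by lra.
  by move/eqP; rewrite mulrn_eq0 => /eqP.
by move/eqP; rewrite sqrf_eq0 gt_eqF.
Qed.

Lemma cis_2pi (m : int) : cis (m%:~R * (pi *+ 2)) = 1.
Proof.
have p1 (k : nat) : cis (k%:R * (pi *+ 2)) = 1.
  by rewrite /cis mulr_natl -[_ *+ k]add0r (periodicn (@cosD2pi R)) (periodicn (@sinD2pi R)) cos0 sin0.
case: m => k; first exact: p1.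
have := p1 k.+1; rewrite /cis NegzE mulrNz mulNr cosN sinN -pmulrn => -[-> ->].
by rewrite oppr0.
Qed.

Lemma cvg_sum_complex (I : finType) (u : I -> nat -> R[i]) (l c : I -> R[i]) :
  (forall i, u i @ \oo --> l i) ->
  (fun k => \sum_i u i k * c i) @ \oo --> \sum_i l i * c i.
Proof.
move=> ul.
have -> : (fun k => \sum_i u i k * c i) = \sum_i (fun k => u i k * c i : R[i]^o).
  by apply/funext => k; rewrite fct_sumE.
apply: (big_ind2 (fun (a : nat -> R[i]^o) (b : R[i]^o) => a @ \oo --> b)).
- exact: cvg_cst.
- by move=> u1 l1 u2 l2 H1 H2; exact: (@cvgD R[i] R[i]^o nat _ _ u1 u2 l1 l2 H1 H2).
by move=> i _; apply: (@cvgMr_tmp R[i]); exact: ul.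
Qed.
End Complex.
End Convergence.

(** * Periodicity in terms of the eigenvalues of a group matrix *)

Section Walk.
Local Open Scope classical_set_scope.
Variables (R : realType) (gT : finGroupType) (f : gT -> R[i]).

Definition group_mx : 'M[R[i]]_#|gT| :=
  \matrix_(a, b) f (enum_val b * (enum_val a)^-1)%g.
Local Notation M := group_mx.

(** [X] stands for the irreducible characters transported to R[i], known here only through their
    degrees, the eigenvector relation and the regular character. *)
Variables (I : finType) (X : I -> gT -> R[i]) (lam : I -> R) (d : I -> nat).
Hypothesis d_gt0 : forall i, (0 < d i)%N.
Hypothesis X1 : forall i, X i 1%g = (d i)%:R.
Hypothesis X_eigen : forall i x, \sum_g f g * X i (g * x)%g = (lam i)%:C%C * X i x.
Hypothesis X_reg : forall x, \sum_i X i 1%g * X i x = #|gT|%:R * (x == 1%g)%:R.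

Definition eigenvec i h : 'cV[R[i]]_#|gT| := \col_b X i (enum_val b * h)%g.

Lemma group_mx_eigen i h : M *m eigenvec i h = (lam i)%:C%C *: eigenvec i h.
Proof.
apply/matrixP => a c; rewrite !mxE -X_eigen.
rewrite (reindex (fun g : gT => enum_rank (g * enum_val a)%g)) /=.
  by apply: eq_bigr => g _; rewrite !mxE enum_rankK mulgK mulgA.
exists (fun b => (enum_val b * (enum_val a)^-1)%g) => [g|b] _.
  by rewrite enum_rankK mulgK.
by rewrite mulgKV enum_valK.
Qed.

Lemma mxpow_eigen k i h : mxpow M k *m eigenvec i h = (lam i)%:C%C ^+ k *: eigenvec i h.
Proof.
elim: k => [|k IH]; first by rewrite /= mul1mx expr0 scale1r.
by rewrite /mxpow iterS -mulmxA -/(mxpow M k) IH -scalemxAr group_mx_eigen scalerA exprSr.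
Qed.

Lemma expSeries_eigen t m i h : expSeries M t m *m eigenvec i h =
  series (fun k => (iC R * (t * lam i)%:C%C) ^+ k / (k`!)%:R) m *: eigenvec i h.
Proof.
rewrite /expSeries /series /= mulmx_suml scaler_suml; apply: eq_bigr => k _.
rewrite -scalemxAl mxpow_eigen scalerA rmorphM /= mulrA [in RHS]exprMn.
by rewrite mulrAC.
Qed.

Lemma card_group_gt0 : (0 < #|gT|)%N. Proof. by apply/card_gt0P; exists 1%g. Qed.

(** On the translates of [X i] the series converges to multiplication by cis (t * lam i). The entry
    of [X i] at 1 is nonzero, so a scalar limit determines this number; conversely the translates
    span, so equal numbers give a scalar limit. *)
Lemma periodic_cis :
  periodic_walk M <-> exists t : R, t != 0 /\ exists gamma, forall i, cis (t * lam i) = gamma.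
Proof.
split=> -[t [t0 [gamma H]]]; exists t; split=> //; exists gamma.
  move=> i; pose a := enum_rank (1%g : gT).
  have Xi0 : X i 1%g != 0 by rewrite X1 pnatr_eq0 -lt0n.
  move/cvg_mx_entry : H => H.
  have lim1 : (fun m => \sum_b expSeries M t m a b * eigenvec i 1%g b ord0) @ \oo -->
      \sum_b gamma%:M a b * eigenvec i 1%g b ord0.
    by apply: cvg_sum_complex => b; exact: H.
  have lim2 : (fun m => \sum_b expSeries M t m a b * eigenvec i 1%g b ord0) @ \oo -->
      \sum_(j : 'I_1) cis (t * lam i) * X i 1%g.
    rewrite (_ : (fun _ => _) = fun m => \sum_(j : 'I_1)
        series (fun k => (iC R * (t * lam i)%:C%C) ^+ k / (k`!)%:R) m * X i 1%g).
      by apply: cvg_sum_complex => j; exact: cvg_cis.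
    apply/funext => m; have := expSeries_eigen t m i 1%g.
    move/matrixP => /(_ a ord0); rewrite !mxE /= => ->.
    by rewrite big_ord1 enum_rankK mulg1.
  have := @cvg_unique _ (@norm_hausdorff R[i] R[i]^o) _ _ _ _ lim2 lim1.
  rewrite big_ord1 (bigD1 a) //= big1 => [|b ba]; last by rewrite !mxE eq_sym (negPf ba) mulr0n mul0r.
  rewrite !mxE eqxx mulr1n addr0 enum_rankK mulg1. move=> E; apply: (mulIf Xi0); exact: (E _).
apply/cvg_mx_entry => a b.
have n0 : #|gT|%:R != 0 :> R[i] by rewrite pnatr_eq0 -lt0n card_group_gt0.
pose c i := X i 1%g * X i (enum_val a * (enum_val b)^-1)%g / #|gT|%:R.
(* The regular character writes each basis vector as a combination of eigenvectors. *)
have delta : delta_mx b (ord0 : 'I_1) = \sum_i (X i 1%g / #|gT|%:R) *: eigenvec i (enum_val b)^-1%g.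
  apply/matrixP => e z; rewrite !ord1 summxE !mxE eqxx andbT.
  transitivity ((\sum_i X i 1%g * X i (enum_val e * (enum_val b)^-1)%g) / #|gT|%:R).
    by rewrite X_reg mulrAC mulfV // mul1r -eq_mulgV1 (inj_eq enum_val_inj).
  by rewrite mulr_suml; apply: eq_bigr => i _; rewrite !mxE mulrAC.
have entry m : expSeries M t m a b =
    \sum_i series (fun k => (iC R * (t * lam i)%:C%C) ^+ k / (k`!)%:R) m * c i.
  have -> : expSeries M t m a b = (expSeries M t m *m delta_mx b (ord0 : 'I_1)) a ord0.
    by rewrite -colE mxE.
  rewrite delta mulmx_sumr summxE; apply: eq_bigr => i _.
  by rewrite -scalemxAr expSeries_eigen !mxE /c mulrCA; congr (_ * _); rewrite mulrAC.
have -> : gamma%:M a b = \sum_i gamma * c i.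
  rewrite -mulr_sumr -mulr_suml X_reg mulrAC mulfV // mul1r -eq_mulgV1 (inj_eq enum_val_inj).
  by rewrite mxE mulr_natr.
rewrite (_ : (fun _ => _) = fun m =>
    \sum_i series (fun k => (iC R * (t * lam i)%:C%C) ^+ k / (k`!)%:R) m * c i).
  by apply: cvg_sum_complex => i; rewrite -(H i); exact: cvg_cis.
by apply/funext.
Qed.

(** This and [fq] say that the trace of M is 0 and that of M ^ 2 is q times the order of the group.
    In the trace formulas below, [lam i] counts with multiplicity [d i ^ 2]. *)
Hypothesis f1 : f 1%g = 0.
Variable q : nat.
Hypothesis fq : \sum_g f g * f g^-1%g = q%:R.

Lemma X_inv x : \sum_i X i 1%g * (lam i)%:C%C * X i x = #|gT|%:R * f x^-1%g.
Proof.
under eq_bigr => i _ do rewrite -mulrA -X_eigen mulr_sumr.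
rewrite exchange_big /= (bigD1 x^-1%g) //= [X in _ + X]big1 => [|g gx].
  under eq_bigr => i _ do rewrite mulVg mulrCA.
  by rewrite -mulr_sumr X_reg eqxx mulr1 mulrC addr0.
under eq_bigr => i _ do rewrite mulrCA.
by rewrite -mulr_sumr X_reg -eq_invg_mul -(inj_eq invg_inj) invgK (negPf gx) !mulr0.
Qed.

Lemma sum_sqr_dim : \sum_i (d i)%:R ^+ 2 = #|gT|%:R :> R.
Proof.
apply: (@complexI R); rewrite rmorph_sum rmorph_nat.
have := X_reg 1%g; rewrite eqxx mulr1 => <-.
by apply: eq_bigr => i _; rewrite X1 rmorphXn /= rmorph_nat.
Qed.

Lemma sum_eigenvalues : \sum_i (d i)%:R ^+ 2 * lam i = 0.
Proof.
apply: (@complexI R); rewrite rmorph_sum rmorph0.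
have := X_inv 1%g; rewrite invg1 f1 mulr0 => E; rewrite -[RHS]E; apply: eq_bigr => i _.
by rewrite X1 rmorphM rmorphXn /= rmorph_nat mulrAC.
Qed.

Lemma sum_sqr_eigenvalues : \sum_i (d i)%:R ^+ 2 * lam i ^+ 2 = #|gT|%:R * q%:R.
Proof.
apply: (@complexI R); rewrite rmorph_sum rmorphM !rmorph_nat -fq mulr_sumr.
transitivity (\sum_g f g * \sum_i X i 1%g * (lam i)%:C%C * X i g).
  under [RHS]eq_bigr => g _ do rewrite mulr_sumr.
  rewrite exchange_big; apply: eq_bigr => i _ /=.
  transitivity (X i 1%g * (lam i)%:C%C * \sum_g f g * X i (g * 1)%g).
    rewrite X_eigen X1 rmorphM !rmorphXn /= rmorph_nat !expr2 -!mulrA; congr (_ * _).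
    by rewrite mulrCA; congr (_ * _); rewrite mulrC.
  by rewrite mulr_sumr; apply: eq_bigr => g _; rewrite mulg1 mulrCA.
by apply: eq_bigr => g _; rewrite X_inv mulrCA.
Qed.

Lemma cis_rational :
  (exists t : R, t != 0 /\ exists gamma, forall i, cis (t * lam i) = gamma) <->
  (forall i j, exists r : rat, lam i * lam j = ratr r).
Proof.
have n0 : #|gT|%:R != 0 :> R by rewrite pnatr_eq0 -lt0n card_group_gt0.
have pi2 : (pi *+ 2 : R) != 0 by rewrite mulrn_eq0 /= gt_eqF ?pi_gt0.
split=> [[t [t0 [gamma H]]] i j|H].
  have /choice[m mE] : forall ij : I * I, exists m : int,
      lam ij.1 - lam ij.2 = m%:~R * (pi *+ 2 / t).
    move=> [k l] /=; have [|m mE] := @cis_eq R (t * lam k) (t * lam l); first by rewrite !H.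
    by exists m; apply: (mulfI t0); rewrite mulrBr mE mulrCA (mulrC t) divfK.
  pose mu := pi *+ 2 / t / #|gT|%:R.
  (* Averaging lam k - lam l over l with weights d l ^ 2, of total #|gT|, leaves lam k because the
     trace vanishes. *)
  pose p k : int := \sum_l ((d l ^ 2)%N : int) * m (k, l).
  have lamE k : lam k = (p k)%:~R * mu.
    have : #|gT|%:R * lam k = \sum_l (d l)%:R ^+ 2 * (lam k - lam l).
      under eq_bigr => l _ do rewrite mulrBr.
      by rewrite sumrB sum_eigenvalues subr0 -mulr_suml sum_sqr_dim.
    move=> E; apply: (mulfI n0); rewrite E /p rmorph_sum mulr_suml mulr_sumr.
    apply: eq_bigr => l _; rewrite (mE (k, l)) rmorphM /= /mu -natrX.
    rewrite -[((d l ^ 2)%N : int)%:~R]/((d l ^ 2)%:R).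
    by rewrite [RHS]mulrCA [in RHS](mulrC #|gT|%:R) divfK // mulrA.
  have [->|i0] := eqVneq (lam i) 0; first by exists 0; rewrite mul0r rmorph0.
  (* S mu^2 is the trace of M ^ 2, which makes mu^2 rational. *)
  pose S : rat := \sum_k (d k)%:R ^+ 2 * (p k)%:~R ^+ 2.
  have S0 : S != 0.
    rewrite gt_eqF // /S (bigD1 i) //= ltr_wpDr ?sumr_ge0 // => [k _|].
      by rewrite mulr_ge0 ?sqr_ge0.
    apply: mulr_gt0; first by rewrite exprn_gt0 ?ltr0n.
    rewrite exprn_even_gt0 //= intr_eq0.
    by apply: contraNneq i0 => pi0; rewrite lamE pi0 mul0r.
  have muE : mu ^+ 2 = ratr (#|gT|%:R * q%:R / S).
    have SR : ratr S = \sum_k (d k)%:R ^+ 2 * (p k)%:~R ^+ 2 :> R.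
      rewrite /S rmorph_sum; apply: eq_bigr => k _.
      by rewrite rmorphM !rmorphXn /= ratr_nat ratr_int.
    have SR0 : ratr S != 0 :> R by rewrite fmorph_eq0.
    rewrite !rmorphM fmorphV /= !ratr_nat -sum_sqr_eigenvalues.
    apply: (canRL (mulfK SR0)); rewrite SR mulr_sumr; apply: eq_bigr => k _.
    by rewrite lamE; move: ((d k)%:R : R) ((p k)%:~R : R) => x y; ring.
  exists ((p i)%:~R * (p j)%:~R * (#|gT|%:R * q%:R / S)).
  by rewrite [RHS]rmorphM /= -muE rmorphM /= !ratr_int !lamE mulrACA expr2.
have [/existsP[i0 li0]|] := boolP [exists i, lam i != 0]; last first.
  rewrite negb_exists => /forallP l0; exists 1; split; first exact: oner_neq0.
  exists 1 => i; have := l0 i; rewrite negbK => /eqP ->.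
  by rewrite mulr0 -(mul0r (pi *+ 2)) -(cis_2pi R 0).
have /choice[r rE] : forall i, exists r : rat, lam i = ratr r * lam i0.
  move=> i; have [a aE] := H i i0; have [b bE] := H i0 i0.
  exists (a / b); rewrite fmorph_div /= -aE -bE invfM mulrA mulfK // divfK //.
(* A common denominator of the ratios lam i / lam i0: with t = 2 pi N / lam i0 every t * lam i is an
   integer multiple of 2 pi. *)
pose N : int := \prod_i denq (r i).
have N0 : N != 0 by apply/prodf_neq0 => i _; rewrite denq_neq0.
exists (N%:~R * (pi *+ 2) / lam i0); split.
  by rewrite !mulf_neq0 ?invr_eq0 // intr_eq0.
exists 1 => i; rewrite -(cis_2pi R (numq (r i) * \prod_(j | j != i) denq (r j))); congr cis.
rewrite (rE i) (_ : _ * (ratr (r i) * lam i0) = N%:~R * ratr (r i) * (pi *+ 2)); last first.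
  by move: (N%:~R : R) (ratr (r i) : R) (lam i0) li0 (pi : R) => x y z z0 w; field.
rewrite /N (bigD1 i) //= !rmorphM /=.
have -> : ratr (r i) = (numq (r i))%:~R / (denq (r i))%:~R :> R by [].
have dn0 : (denq (r i))%:~R != 0 :> R by rewrite intr_eq0 denq_neq0.
by move: ((denq (r i))%:~R : R) ((numq (r i))%:~R : R) dn0 (pi : R) => x y x0 w; field.
Qed.
End Walk.

(** * Transfer between algC and R[i] *)

(** The usual argument for Hermitian matrices: mu times the positive norm of X is a Hermitian form
    at X, hence its own conjugate. *)
Lemma eigenvalue_real (R : realType) (gT : finGroupType) (f X : gT -> R[i]) (mu : R[i]) :
  (forall g, f (g^-1)%g = conjc (f g)) -> X 1%g != 0 ->
  (forall x, \sum_g f g * X (g * x)%g = mu * X x) -> mu = (complex.Re mu)%:C%C.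
Proof.
move=> fV X1 Xmu.
pose N := \sum_x X x * conjc (X x).
have N0 : N != 0.
  rewrite gt_eqF // /N (bigD1 1%g) //= ltr_wpDr ?sumr_ge0 // => [x _|].
    exact: mulcJ_ge0.
  by rewrite lt_neqAle mulcJ_ge0 andbT eq_sym mulf_neq0 ?conjc_eq0.
pose S := \sum_x \sum_g f g * X (g * x)%g * conjc (X x).
have SE : S = mu * N.
  by rewrite /S /N mulr_sumr; apply: eq_bigr => x _; rewrite -mulr_suml Xmu mulrA.
have NJ : conjc N = N.
  rewrite /N rmorph_sum; apply: eq_bigr => x _.
  by rewrite rmorphM /= conjcK mulrC.
have SJ : conjc S = S.
  rewrite /S rmorph_sum /=.
  transitivity (\sum_x \sum_g f (g^-1)%g * conjc (X (g * x)%g) * X x).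
    apply: eq_bigr => x _; rewrite rmorph_sum; apply: eq_bigr => g _.
    by rewrite !rmorphM /= conjcK fV.
  rewrite exchange_big [RHS]exchange_big /= (reindex_inj invg_inj) /=.
  apply: eq_bigr => g _; rewrite (reindex_inj (mulgI g)) /=.
  by apply: eq_bigr => x _; rewrite invgK mulKg mulrAC.
have : conjc mu = mu.
  have muN : conjc (mu * N) = conjc mu * N by rewrite rmorphM /= NJ.
  by apply: (mulIf N0); rewrite -muN -SE SJ.
by case: mu {Xmu SE} => a b [] /eqP; rewrite -subr_eq0 -opprD oppr_eq0 -mulr2n mulrn_eq0 /= => /eqP ->.
Qed.

Section Transfer.
Variables (R : realType) (gT : finGroupType).

(** Characters take values in algC while the walk lives over R[i]; a number field embedded in both
    carries identities and rationality across. *)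
Lemma common_number_field :
  exists (K : fieldExtType rat) (e1 : {rmorphism K -> algC}) (e2 : {rmorphism K -> R[i]}),
  (exists j, e1 j = 'i /\ e2 j = iC R) /\
  (forall (i : Iirr [set: gT]) g, exists a, e1 a = chr i g).
Proof.
(* The factor 4 puts 'i into the cyclotomic field. *)
pose m := (4 * #|gT|)%N.
have m0 : (0 < m)%N by rewrite muln_gt0 card_group_gt0.
(* Applied to a cyclic group of order [m], this gives the m-th cyclotomic field, with the character
   values at all elements of order dividing [m]. *)
have [K _ [e1 _ [w [wprim genw] vals]]] := group_num_field_exists [set: 'I_m.-1.+1]%G.
rewrite cardsT card_ord prednK // in wprim vals.
have [phi _] := @num_field_embedding K w R[i] genw.
have [j ji] : exists j : K, e1 j = 'i.
  have wp : m.-primitive_root (e1 w) by rewrite fmorph_primitive_root.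
  have i1 : 'i ^+ m = 1 :> algC by rewrite /m exprM -[4%N]/(2 * 2)%N exprM sqrCi sqrrN !expr1n.
  by have [k ->] := prim_rootP wp i1; exists (w ^+ k); rewrite rmorphXn.
have jj : phi j ^+ 2 == iC R ^+ 2.
  have -> : iC R ^+ 2 = -1 by rewrite sqr_i.
  rewrite -rmorphXn (_ : j ^+ 2 = -1) ?rmorphN1 //.
  by apply: (fmorph_inj e1); rewrite rmorphXn /= ji sqrCi rmorphN1.
have vals' (i : Iirr [set: gT]) g : exists a, e1 a = chr i g.
  have [|a aE] := vals _ _ _ (irr_char i) g; last by exists a.
  by rewrite /m dvdn_mull // -cardsT order_dvdG // finset.inE.
(* The embedding may send [j] to -i; conjugation then corrects it. *)
move: jj; rewrite eqf_sqr => /orP[]/eqP pj.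
  by exists K, e1, phi; split=> //; exists j.
exists K, e1, (@conjc R \o phi); split=> //; exists j; split=> //=.
by rewrite pj rmorphN /= /iC /conjc; congr Complex; rewrite ?oppr0 ?opprK.
Qed.

Variables (Ci C1 Cm1 : {set gT}).
Hypotheses (Ci1 : (1%g \notin Ci)) (C11 : (1%g \notin C1)) (Cm11 : (1%g \notin Cm1)).
Hypotheses (cCi : conj_closed Ci) (cC1 : conj_closed C1) (cCm1 : conj_closed Cm1).
Hypotheses (sC1 : setinv C1 = C1) (sCm1 : setinv Cm1 = Cm1).

Definition walk_weightR (g : gT) : R[i] :=
  iC R * (odd_part Ci g)%:~R + (even_part C1 Cm1 g)%:~R.

Lemma AmxC_entry (C : {set gT}) a b :
  AmxC R C a b = ((enum_val b * (enum_val a)^-1)%g \in C)%:R.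
Proof.
rewrite /AmxC summxE; under eq_bigr => g _ do rewrite mxE.
have [bC|bC] := boolP (_ \in C).
  by rewrite (bigD1 _ bC) /= eqxx big1 ?addr0 // => g /andP[_]; rewrite eq_sym => /negPf ->.
by rewrite big1 // => g gC; case: eqP => // E; rewrite E gC in bC.
Qed.

Lemma mixedM_group_mx : mixedM R Ci C1 Cm1 = group_mx walk_weightR.
Proof.
apply/matrixP => a b; rewrite [in LHS]/mixedM !mxE !AmxC_entry /walk_weightR /odd_part /even_part.
by rewrite !rmorphB /= !rmorph_nat; ring.
Qed.

Lemma walk_weightR1 : walk_weightR 1%g = 0.
Proof.
rewrite /walk_weightR /odd_part /even_part mem_setinv invg1.
by rewrite (negPf Ci1) (negPf C11) (negPf Cm11) subrr mulr0 addr0.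
Qed.

Lemma walk_weightRV g : walk_weightR (g^-1)%g = - (iC R * (odd_part Ci g)%:~R) + (even_part C1 Cm1 g)%:~R.
Proof. by rewrite /walk_weightR odd_partV even_partV // rmorphN mulrN. Qed.

Lemma walk_weightR_sqr : exists q : nat, \sum_g walk_weightR g * walk_weightR (g^-1)%g = q%:R.
Proof.
exists (\sum_g (`|odd_part Ci g| ^ 2 + `|even_part C1 Cm1 g| ^ 2))%N.
rewrite natr_sum; apply: eq_bigr => g _; rewrite walk_weightRV /walk_weightR.
move: (odd_part _ _) (even_part _ _ _) => x y.
have sq (z : int) : (`|z| ^ 2)%N%:R = z%:~R ^+ 2 :> R[i].
  by rewrite -[_%:R]/((`|z| ^ 2)%N : int)%:~R -abszX gez0_abs ?sqr_ge0 // rmorphXn.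
rewrite natrD !sq.
transitivity (- iC R ^+ 2 * x%:~R ^+ 2 + y%:~R ^+ 2); first by ring.
by rewrite sqr_i opprK mul1r.
Qed.

Lemma periodic_modes : periodic_walk (mixedM R Ci C1 Cm1) <->
  forall i j, cmode (walk_weight Ci C1 Cm1) i * cmode (walk_weight Ci C1 Cm1) j \in Crat.
Proof.
have [K [e1 [e2 [[j [j1 j2]] vals]]]] := common_number_field.
have /choice[XK XKE] : forall ig : Iirr [set: gT] * gT, exists a, e1 a = chr ig.1 ig.2.
  by move=> [i g]; apply: vals.
(* Weight, characters and modes are formed in [K]: identities known in algC are pulled back along
   [e1] and pushed forward by [e2]. *)
pose fK g : K := j * (odd_part Ci g)%:~R + (even_part C1 Cm1 g)%:~R.
have f1E g : e1 (fK g) = walk_weight Ci C1 Cm1 g.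
  by rewrite /fK /walk_weight rmorphD rmorphM !rmorph_int j1.
have f2E g : e2 (fK g) = walk_weightR g.
  by rewrite /fK /walk_weightR rmorphD rmorphM !rmorph_int j2.
have w_class := walk_weight_class cCi cC1 cCm1.
pose X i g := e2 (XK (i, g)).
pose WK i : K := (\sum_g fK g * XK (i, g)) / XK (i, 1%g).
have W1E i : e1 (WK i) = cmode (walk_weight Ci C1 Cm1) i.
  rewrite /WK /cmode fmorph_div rmorph_sum (XKE (i, 1%g)); congr (_ / _).
  by apply: eq_bigr => g _; rewrite rmorphM /= f1E (XKE (i, g)).
have eigenK i x : \sum_g fK g * XK (i, (g * x)%g) = WK i * XK (i, x).
  apply: (fmorph_inj e1); rewrite rmorphM rmorph_sum /= W1E (XKE (i, x)) -chr_eigen //.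
  by apply: eq_bigr => g _; rewrite rmorphM /= f1E (XKE (i, _)).
have regK x : \sum_i XK (i, 1%g) * XK (i, x) = #|gT|%:R * (x == 1%g)%:R.
  apply: (fmorph_inj e1); rewrite rmorphM !rmorph_nat -chr_reg rmorph_sum.
  by apply: eq_bigr => i _; rewrite rmorphM /= !XKE.
have /choice[d dE] : forall i : Iirr [set: gT], exists d : nat, chr i 1%g = d%:R.
  by move=> i; apply/natrP; exact: Cnat_irr1.
have d0 i : (0 < d i)%N by have := chr1_gt0 i; rewrite dE ltr0n.
have X1 i : X i 1%g = (d i)%:R.
  rewrite /X (_ : XK _ = (d i)%:R) ?rmorph_nat //.
  by apply: (fmorph_inj e1); rewrite XKE rmorph_nat dE.
pose lam i := complex.Re (e2 (WK i)).
have eigenR i x : \sum_g walk_weightR g * X i (g * x)%g = e2 (WK i) * X i x.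
  rewrite /X -rmorphM -eigenK rmorph_sum.
  by apply: eq_bigr => g _; rewrite rmorphM /= f2E.
have lamE i : e2 (WK i) = (lam i)%:C%C.
  apply: (@eigenvalue_real _ gT walk_weightR (X i)) => // [g|].
    rewrite walk_weightRV /walk_weightR; move: (odd_part _ _) (even_part _ _ _) => x y.
    rewrite rmorphD rmorphM /= -!(rmorph_int (real_complex R)) !conjc_real.
    by rewrite -mulNr; congr (_ * _ + _); rewrite /iC /conjc; congr Complex; rewrite oppr0.
  by rewrite X1 pnatr_eq0 -lt0n.
have [q qE] := walk_weightR_sqr.
have X_eigen i x : \sum_g walk_weightR g * X i (g * x)%g = (lam i)%:C%C * X i x.
  by rewrite eigenR lamE.
have X_reg x : \sum_i X i 1%g * X i x = #|gT|%:R * (x == 1%g)%:R.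
  have := congr1 e2 (regK x); rewrite rmorphM !rmorph_nat => <-.
  by rewrite rmorph_sum; apply: eq_bigr => i _; rewrite rmorphM.
rewrite mixedM_group_mx (periodic_cis d0 X1 X_eigen X_reg).
rewrite (cis_rational d0 X1 X_eigen X_reg walk_weightR1 qE).
(* A product of modes is rational in algC or in R[i] exactly when it is rational in [K], as both
   embeddings fix Q. *)
split=> H k l; have := H k l.
  case=> r rE; rewrite -!W1E -rmorphM (_ : WK k * WK l = r%:A).
    by rewrite alg_num_field fmorph_rat; apply/CratP; exists r.
  apply: (fmorph_inj e2); rewrite alg_num_field fmorph_rat rmorphM /= !lamE -rmorphM rE.
  by rewrite fmorph_rat.
move=> /CratP[r]; rewrite -!W1E -rmorphM -(fmorph_rat e1) => /fmorph_inj rE.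
exists r; apply: (@complexI R); rewrite rmorphM /= -!lamE -rmorphM rE !fmorph_rat //.
Qed.
End Transfer.

Theorem theorem10p2 (R : realType) (gT : finGroupType) (Ci C1 Cm1 : {set gT}) :
  (1%g \notin Ci) -> (1%g \notin C1) -> (1%g \notin Cm1) ->
  conj_closed Ci -> conj_closed C1 -> conj_closed Cm1 ->
  [disjoint Ci & setinv Ci] -> [disjoint Ci & C1] -> [disjoint Ci & Cm1] ->
  [disjoint setinv Ci & C1] -> [disjoint setinv Ci & Cm1] -> [disjoint C1 & Cm1] ->
  setinv C1 = C1 -> setinv Cm1 = Cm1 ->
  periodic_walk (mixedM R Ci C1 Cm1) <->
  exists D : nat, [/\ (0 < D)%N /\ squarefree D,
    (admissible (expG gT) (- (D : int)) -> union_of_sim (- (D : int)) Ci),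
    (~ admissible (expG gT) (- (D : int)) -> Ci = finset.set0),
    (admissible (expG gT) (D : int) ->
       [/\ union_of_sim (D : int) C1, union_of_sim (D : int) Cm1 &
           ((D != 1)%N -> exists k : nat,
              [/\ (k < expG gT)%N, coprime k (expG gT),
                  ~ inH (expG gT) (D : int) k & C1 = setpow Cm1 k])]) &
    (~ admissible (expG gT) (D : int) -> C1 = finset.set0 /\ Cm1 = finset.set0)].
Proof.
move=> Ci1 C11 Cm11 cCi cC1 cCm1 dCi _ _ _ _ dC1 sC1 sCm1.
(* The modes are real because the weight is Hermitian, so rational pairwise products amount to one
   common sqrt(D). *)
rewrite periodic_modes // common_sqrt; last first.
  by move=> i; apply: cmode_conj => g; apply: walk_weightV.
split=> -[D].
  case=> D0 sqf /(walk_modes_split Ci sC1 sCm1 D0)[].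
  move=> /(odd_modes_rational cCi dCi D0 sqf)[H1 H2].
  move=> /(even_modes_rational cC1 cCm1 dC1 D0 sqf)[H3 H4].
  by exists D.
case=> -[D0 sqf] H1 H2 H3 H4; exists D; split=> //.
apply/(walk_modes_split Ci sC1 sCm1 D0); split.
  exact/(odd_modes_rational cCi dCi D0 sqf).
exact/(even_modes_rational cC1 cCm1 dC1 D0 sqf).
Qed.
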